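(* Let $G$ be a $12$-representable (finite, connected) square grid graph. Then there exist a labeling of $G$ and a word $w$ $12$-representing the labeled graph such that in $w$: the label of each corner node occurs exactly twice (and for no good labeling can the label of a corner node appear only once in such a word); between the two copies of the label of a corner node there are exactly two other letters; and the label of every non-corner node occurs exactly once.
   Context: The grid graph is the infinite graph on $\mathbb{Z}^2$ with vertices adjacent iff at Euclidean distance $1$. A square of an induced subgraph $H$ of it is a set of four vertices of $H$ of the form $\{(x,y),(x+1,y),(x,y+1),(x+1,y+1)\}$. A square grid graph is a finite connected induced subgraph of the grid graph in which every vertex and edge lies in some square of it. A labeled graph has distinct positive integers as vertices. A word $w$ $12$-represents a labeled graph $G=(V,E)$ if the set of letters of $w$ is $V$ and for all distinct $x,y\in V$: $xy\notin E$ iff some occurrence of $\min(x,y)$ precedes some occurrence of $\max(x,y)$ in $w$. An unlabeled graph is $12$-representable if some labeling of it is $12$-representable. A labeling is good if it has none of: (i) labels $p<q<r$ inducing exactly the edges $pq,qr$; (ii) labels $p<q<r<s$ inducing exactly the edges $pr,qs$; (iii) labels $p<q<r<s$ inducing exactly the edges $ps,qr$. A square $S$ is an end-square if it has an edge $ab$ (of the $4$-cycle $S$) such that neither $a$ nor $b$ is a vertex of a square other than $S$. A corner node is a node that belongs to exactly one square, where this square is not an end-square and shares an edge with each of two other squares. *)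

(* Defs.v *)
From mathcomp Require Import all_boot all_order all_algebra finmap.

Set Implicit Arguments.
Unset Strict Implicit.
Unset Printing Implicit Defensive.

Import Order.TTheory GRing.Theory Num.Theory.

Local Open Scope fset_scope.

Section LabeledGraphs.

(* A finite graph is given by its vertex set V and an adjacency relation e on
   the ambient type; only the restriction of e to V matters. A labeling assigns
   distinct positive integers to the vertices; its values outside V are
   irrelevant. *)
Variables (T : choiceType) (V : {fset T}) (e : rel T).

Definition connected_graph : Prop :=
  forall u v : T, u \in V -> v \in V ->
    exists2 p : seq T, path e u p & all (fun z => z \in V) p /\ last u p = v.

Definition labeling (f : T -> nat) : Prop :=
  {in V, forall u, 0 < f u} /\ {in V &, injective f}.

Definition occurs_before (a b : nat) (w : seq nat) : Prop :=
  exists i j : nat, [/\ i < j, j < size w, nth 0 w i = a & nth 0 w j = b].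

Definition word_represents12 (f : T -> nat) (w : seq nat) : Prop :=
  (forall a : nat, a \in w <-> exists2 u, u \in V & f u = a) /\
  (forall u v : T, u \in V -> v \in V -> u <> v ->
     (~~ e u v <-> occurs_before (minn (f u) (f v)) (maxn (f u) (f v)) w)).

Definition representable12 : Prop :=
  exists f : T -> nat, labeling f /\ exists w : seq nat, word_represents12 f w.

Definition good_labeling (f : T -> nat) : Prop :=
  [/\ labeling f,
      ~ (exists p q r : T,
          [/\ [/\ p \in V, q \in V & r \in V],
              f p < f q < f r &
              [/\ e p q, e q r & ~~ e p r]]),
      ~ (exists p q r s : T,
          [/\ [/\ p \in V, q \in V, r \in V & s \in V],
              [/\ f p < f q, f q < f r & f r < f s],
              e p r /\ e q s &
              [/\ ~~ e p q, ~~ e p s, ~~ e q r & ~~ e r s]]) &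
      ~ (exists p q r s : T,
          [/\ [/\ p \in V, q \in V, r \in V & s \in V],
              [/\ f p < f q, f q < f r & f r < f s],
              e p s /\ e q r &
              [/\ ~~ e p q, ~~ e p r, ~~ e q s & ~~ e r s]])].

End LabeledGraphs.

Local Open Scope ring_scope.

Definition gpoint : Type := (int * int)%type.

Definition grid_adj : rel gpoint :=
  fun u v => (u.1 - v.1) ^+ 2 + (u.2 - v.2) ^+ 2 == 1.

(* The four points of the unit square whose lower left corner is z; squares
   are identified with their lower left corners. *)
Definition square_nodes (z : gpoint) : {fset gpoint} :=
  [fset z; (z.1 + 1, z.2); (z.1, z.2 + 1); (z.1 + 1, z.2 + 1)].

Section Squares.

Variable V : {fset gpoint}.

Definition is_square (z : gpoint) : Prop := square_nodes z `<=` V.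

Definition square_grid_graph : Prop :=
  [/\ connected_graph V grid_adj,
      forall u, u \in V -> exists2 z, is_square z & u \in square_nodes z &
      forall u v, u \in V -> v \in V -> grid_adj u v ->
        exists2 z, is_square z & u \in square_nodes z /\ v \in square_nodes z].

Definition square_edge (z a b : gpoint) : Prop :=
  [/\ a \in square_nodes z, b \in square_nodes z & grid_adj a b].

Definition end_square (z : gpoint) : Prop :=
  is_square z /\
  exists a b, square_edge z a b /\
    forall z', is_square z' -> z' <> z ->
      a \notin square_nodes z' /\ b \notin square_nodes z'.

Definition share_edge (z z' : gpoint) : Prop :=
  exists a b, square_edge z a b /\ square_edge z' a b.

Definition corner_node (v : gpoint) : Prop :=
  v \in V /\
  exists z,
    [/\ is_square z /\ v \in square_nodes z,
        forall z', is_square z' -> v \in square_nodes z' -> z' = z,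
        ~ end_square z &
        exists z1 z2,
          [/\ is_square z1 /\ is_square z2, [/\ z1 <> z, z2 <> z & z1 <> z2],
              share_edge z z1 & share_edge z z2]].

End Squares.

Local Close Scope ring_scope.

(* For a letter a occurring exactly twice in w: exactly two letters stand
   between its two copies. *)
Definition two_between (a : nat) (w : seq nat) : Prop :=
  exists i, [/\ i + 3 < size w, nth 0 w i = a & nth 0 w (i + 3) = a].

(* Main.v *)
Require Import Defs.
From mathcomp Require Import all_boot all_order all_algebra finmap.
From mathcomp Require Import zify.

(** Only the first and last occurrences of a letter matter in a word, and the grid is bipartite, so
    a 12-representation makes every vertex either lower or higher than all its neighbours, and two
    edges inducing a matching span disjoint intervals of labels. Consequently the least high
    vertex has degree two and lies in a square with an edge [ab] whose ends are in no other
    square: the graph is a chain of squares, each glued to the next along an edge or a vertex.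

    Removing that square gives a smaller graph with the same labels, and the word is rebuilt by
    adding the squares back. Gluing a square with new low vertex [a] and new high vertex [b] on
    the edge [xy], [x] first in the labelling and [y] first in the word, means labelling
    [a x b ...] and writing [b y a ...]; where the chain turns, the corner vertex is first
    doubled, around exactly two letters.

    A corner cannot occur once: with a single position for it, the eight vertices of the three
    squares around it give contradictory inequalities between labels and positions. *)

Set Implicit Arguments.
Unset Strict Implicit.
Unset Printing Implicit Defensive.

Import Order.TTheory GRing.Theory Num.Theory.

(** * Words over the vertices *)

Section Words.

Variables (T : eqType) (e : rel T).

(** The gluing rule is dictated by [before]. With the smallest label, [a] must precede a copy of
    every letter except [b] and [y], so it stands right behind [y], with a copy of every other old
    letter still to come. Alone at the front of the word, [b] precedes everything, so it is adjacent
    exactly to the smaller labels, [a] and [x]. The rest must therefore present [x] first in the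
    labelling and [y] first in the word, up to letters that occur again later. After a straight step
    it does so. At a turn the corner is in the way: a low corner is labelled before [x], or a high
    corner is written before [y]. A second copy helps: it allows the low corner to be relabelled
    above [x], or leaves a copy of the high corner behind [a]. The gap of two is [v z x v] for a low
    corner [v]; for a high corner [u] it comes from [u y u], widened to [u y a u] by the insertion
    of [a]. The low case needs exactly one letter [z] between the corner and [x], which is why the
    invariant [state] tracks the beginning of the word. *)

Fixpoint before (w : seq T) (u v : T) : bool :=
  if w is z :: w' then ((z == u) && (v \in w')) || before w' u v else false.

Lemma before_mem w u v : before w u v -> (u \in w) && (v \in w).
Proof.
elim: w => //= z w IH /orP[/andP[/eqP-> vw]|/IH/andP[uw vw]];
  by rewrite !inE ?eqxx ?uw ?vw ?orbT.
Qed.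

Lemma beforeP x0 w u v :
  reflect (exists i j, [/\ i < j, j < size w, nth x0 w i = u & nth x0 w j = v])
          (before w u v).
Proof.
apply: (iffP idP).
  elim: w => //= z w IH /orP[/andP[/eqP-> vw]|/IH[i [j [ij jw iu jv]]]].
    by exists 0, (index v w).+1; split=> //=; rewrite ?ltnS ?index_mem ?nth_index.
  by exists i.+1, j.+1.
elim: w => [|z w IH] [i [[|j] [//= ij jw iu jv]]].
case: i ij iu => [_ /= ->|i ij iu]; first by rewrite eqxx -jv mem_nth.
by rewrite IH ?orbT //; exists i, j.
Qed.

Lemma before_filter (P : pred T) w u v :
  P u -> P v -> before (filter P w) u v = before w u v.
Proof.
move=> Pu Pv; elim: w => //= z w IH.
case: ifP => [Pz|nPz] /=; first by rewrite IH mem_filter Pv.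
by rewrite IH; case: eqP nPz => // ->; rewrite Pu.
Qed.

Lemma before_index s u v : uniq s -> before s u v = (index u s < index v s) && (v \in s).
Proof.
elim: s => //= z s IH /andP[zs us]; rewrite inE [v == z]eq_sym IH //.
case: (z =P u) => [_|_]; case: (z =P v) => [zv|_] //=; rewrite ?ltn0 ?ltnS //=.
- by rewrite -zv (negPf zs) andbF.
- by case: (v \in s); rewrite ?andbF.
- by rewrite -zv (negPf zs) andbF.
Qed.

(* The word [w] represents the graph on the letters of [s] labelled by position in [s]. *)
Definition rep (s w : seq T) : Prop :=
  forall u v, before s u v -> e u v = ~~ before w u v.

Definition gap3 (v : T) (w : seq T) : Prop :=
  exists w1 p q w2, w = w1 ++ [:: v, p, q, v & w2].

Lemma gap3_cat v w1 w : gap3 v w -> gap3 v (w1 ++ w).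
Proof. by case=> [w2 [p [q [w3 ->]]]]; exists (w1 ++ w2), p, q, w3; rewrite catA. Qed.

Lemma gap3_cons v z w : gap3 v w -> gap3 v (z :: w).
Proof. exact: (@gap3_cat v [:: z]). Qed.

Lemma gap3_behead v z w : v != z -> gap3 v (z :: w) -> gap3 v w.
Proof.
move=> vz [[|z' w1] [p [q [w2 /= E]]]]; case: E => [Ez E].
  by rewrite Ez eqxx in vz.
by exists w1, p, q, w2.
Qed.

Lemma gap3_drop v w1 w : v \notin w1 -> gap3 v (w1 ++ w) -> gap3 v w.
Proof.
elim: w1 => //= z w1 IH; rewrite inE negb_or => /andP[vz vw] /(gap3_behead vz).
exact: IH.
Qed.

Hypothesis e_sym : symmetric e.

Lemma before_cat w1 w2 u v :
  before (w1 ++ w2) u v =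
  [|| before w1 u v, (u \in w1) && (v \in w2) | before w2 u v].
Proof.
elim: w1 => //= z w1 ->; rewrite mem_cat inE [u == z]eq_sym.
case: (z == u) => //=; case: (v \in w1) => //=.
by case: (v \in w2); rewrite ?orbT //= ?orbF ?andbF.
Qed.

Lemma before_notl w u v : u \notin w -> before w u v = false.
Proof. by move=> uw; apply/negP => /before_mem; rewrite (negPf uw). Qed.

Lemma before_notr w u v : v \notin w -> before w u v = false.
Proof. by move=> vw; apply/negP => /before_mem; rewrite (negPf vw) andbF. Qed.

(** [P] marks the old letters. Their relative order is untouched in the labelling and in the word,
    so only pairs with a new letter remain to be checked. *)
Lemma rep_extend (P : pred T) s w :
  rep (filter P s) (filter P w) ->
  (forall u v, before s u v -> ~~ P u || ~~ P v -> e u v = ~~ before w u v) ->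
  rep s w.
Proof.
move=> R N u v uv; have [Pu|nPu] := boolP (P u); last by apply: N; rewrite ?nPu.
have [Pv|nPv] := boolP (P v); last by apply: N; rewrite ?nPv ?orbT.
by rewrite -(before_filter w Pu Pv); apply: R; rewrite before_filter.
Qed.

Lemma filter_id (P : pred T) (s : seq T) : {in s, forall z, P z} -> filter P s = s.
Proof. by move=> sP; apply/all_filterP/allP. Qed.

(** Here [p] plays [x] and [q] plays [y]. The letters of [m] may stand before [q] because each has
    another copy in [w], hence behind [a]; in the applications [m] is empty or consists of a doubled
    high corner. *)
Lemma rep_edge (P : pred T) p t m q w a b :
  P =i p :: t -> P =i m ++ q :: w -> p \notin t ->
  q \notin w -> {subset m <= w} ->
  a \notin P -> b \notin P -> a != b -> e a b ->
  {in P, forall v, e a v = (v == q)} ->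
  {in P, forall v, e b v = (v == p)} ->
  rep (p :: t) (m ++ q :: w) -> rep [:: a, p, b & t] (b :: m ++ [:: q, a & w]).
Proof.
move=> Ms Mw pt qw mw aP bP ab eab ea eb R.
have Pq : P q by move: (Mw q); rewrite mem_cat inE eqxx orbT.
have Pp : P p by move: (Ms p); rewrite inE eqxx.
have Pm : {in m, forall z, P z} by move=> z zm; move: (Mw z); rewrite mem_cat zm.
have Pw : {in w, forall z, P z} by move=> z zm; move: (Mw z); rewrite mem_cat inE zm !orbT.
have Pt : {in t, forall z, P z} by move=> z zm; move: (Ms z); rewrite inE zm !orbT.
have am : a \notin m by apply: contra aP => /Pm.
have aw : a \notin w by apply: contra aP => /Pw.
have bm : b \notin m by apply: contra bP => /Pm.
have bw : b \notin w by apply: contra bP => /Pw.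
have aq : q == a = false by apply/negP => /eqP E; move: aP; rewrite -E => /negP[].
have bq : b == q = false by apply/negP => /eqP E; move: bP; rewrite E => /negP[].
have pb : b == p = false by apply/negP => /eqP E; move: bP; rewrite E => /negP[].
have ba : b == a = false by rewrite eq_sym (negPf ab).
have nPa : P a = false := negPf aP.
have nPb : P b = false := negPf bP.
have wP z : P z -> z != q -> z \in w.
  move=> Pz zq; move: (Mw z); rewrite mem_cat inE (negPf zq) /=.
  by case: (boolP (z \in m)) => [/mw //|_ /=] <-.
apply: (@rep_extend P).
  rewrite /= filter_cat /= nPa nPb Pp Pq.
  by rewrite !filter_id.
move=> u v /= /or4P[/andP[/eqP<-]|/andP[/eqP<-]|/andP[/eqP<-]|];
  rewrite before_cat /= !mem_cat !inE.
- rewrite ba aq eqxx (negPf am) !before_notl //= orbF => vin _.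
  have {vin}[->|Pv] : v = b \/ P v.
    by case/or3P: vin => [/eqP->|/eqP->|/Pt]; auto.
    by rewrite eab bw.
  rewrite ea //; case: eqP => [->|/eqP vq]; first by rewrite qw.
  by rewrite wP.
- rewrite Pp /= => /orP[/eqP->|/Pt -> //] _.
  rewrite pb e_sym eb // eqxx /= bq [b == a]eq_sym (negPf ab).
  by rewrite !before_notr ?(negPf bm) ?(negPf bw) ?andbF.
- move=> vt _; rewrite eqxx /=; have Pv := Pt _ vt.
  rewrite eb //; case: eqP => [vp|_]; first by rewrite -vp vt in pt.
  have: v \in m ++ q :: w by rewrite -Mw.
  by rewrite mem_cat inE => /or3P[->|->|->]; rewrite ?orbT.
- by move=> /before_mem/andP[/Pt -> /Pt ->].
Qed.

(** Gluing at the low vertex [p]. Standing alone at the front of the word, [b] and [y] are adjacent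
    to the smaller labels [a] and [p] only; they come in the same order in the labelling and in the
    word, hence are not adjacent to each other. *)
Lemma rep_vertex_low (P : pred T) p t w a b y :
  P =i p :: t -> P =i w -> p \notin t ->
  a \notin P -> b \notin P -> y \notin P -> uniq [:: a; b; y] ->
  e a b -> e a y -> ~~ e b y ->
  {in P, forall v, e a v = false} ->
  {in P, forall v, e b v = (v == p)} ->
  {in P, forall v, e y v = (v == p)} ->
  rep (p :: t) w -> rep [:: a, p, b, y & t] [:: b, y, a & w].
Proof.
move=> Ms Mw pt aP bP yP Un eab eay eby ea eb ey R.
have Pp : P p by move: (Ms p); rewrite inE eqxx.
have Pw z : P z = (z \in w) by exact: Mw.
have Pt : {in t, forall z, P z} by move=> z zm; move: (Ms z); rewrite inE zm !orbT.
have nPa : P a = false := negPf aP.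
have nPb : P b = false := negPf bP.
have nPy : P y = false := negPf yP.
have [ab ay yb] : [/\ a != b, a != y & b != y].
  by move: Un; rewrite /= !inE !andbT negb_or => /andP[/andP[-> ->] ->].
have tp z : z \in t -> z == p = false.
  by move=> zt; apply/negP => /eqP E; rewrite -E zt in pt.
have neq x z : P z -> ~~ P x -> (z == x = false) * (x == z = false).
  move=> Pz Px; rewrite [x == z]eq_sym; suff -> : (z == x) = false by [].
  by apply/negP => /eqP E; rewrite -E Pz in Px.
apply: (@rep_extend P).
  by rewrite /= nPa nPb nPy Pp !filter_id // => z; rewrite -Pw.
move=> u v /= /or4P[/andP[/eqP<-]|/andP[/eqP<-]|/andP[/eqP<-]|].
- rewrite !inE !eqxx /= [b == a]eq_sym [y == a]eq_sym (negPf ab) (negPf ay) /=.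
  rewrite before_notl -?Pw ?nPa // orbF.
  case/or4P=> [/eqP->|/eqP->|/eqP->|/Pt Pv] _; rewrite ?eab ?eay ?nPb ?nPy ?ea ?Pp //.
  by rewrite Pv.
- rewrite !inE Pp /= => /or3P[/eqP->|/eqP->|/Pt->] // _.
    rewrite e_sym eb // eqxx (neq b p) // (neq y p) ?nPy // (neq a p) ?nPa //=.
    by rewrite before_notr // -Pw nPb.
  rewrite e_sym ey // eqxx (neq b p) ?nPb // (neq y p) ?nPy // (neq a p) ?nPa //=.
  by rewrite before_notr // -Pw nPy.
- rewrite !inE eqxx => /orP[/eqP->|vt] _; first by rewrite eqxx (negPf eby).
  by have Pv := Pt _ vt; rewrite eb // (tp _ vt) -Pw Pv !orbT.
case/orP=> [/andP[/eqP<- vt] _|/before_mem/andP[/Pt ut /Pt vt]]; last first.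
  by rewrite ut vt.
by have Pv := Pt _ vt; rewrite !inE eqxx ey // (tp _ vt) -Pw Pv !orbT.
Qed.

(** Gluing at the high vertex [q]. Having the smallest labels and standing just behind the only copy
    of [q], both [a] and [x] precede every old letter except [q]. *)
Lemma rep_vertex_high (P : pred T) s q w a x b :
  P =i s -> P =i q :: w -> q \notin w ->
  a \notin P -> x \notin P -> b \notin P -> uniq [:: a; x; b] ->
  e a b -> e x b -> ~~ e a x ->
  {in P, forall v, e b v = false} ->
  {in P, forall v, e a v = (v == q)} ->
  {in P, forall v, e x v = (v == q)} ->
  rep s (q :: w) -> rep [:: a, x, b & s] [:: b, q, a, x & w].
Proof.
move=> Ms Mw qw aP xP bP Un eab exb eax eb ea ex R.
have Pq : P q by move: (Mw q); rewrite inE eqxx.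
have Ps z : P z = (z \in s) by exact: Ms.
have Pw : {in w, forall z, P z} by move=> z zm; move: (Mw z); rewrite inE zm !orbT.
have wP z : P z -> z != q -> z \in w.
  by move=> Pz zq; move: (Mw z); rewrite inE (negPf zq) /= => <-.
have nPa : P a = false := negPf aP.
have nPx : P x = false := negPf xP.
have nPb : P b = false := negPf bP.
have [ax ab xb] : [/\ a != x, a != b & x != b].
  by move: Un; rewrite /= !inE !andbT negb_or => /andP[/andP[-> ->] ->].
have neq z u : P z -> ~~ P u -> (z == u = false) * (u == z = false).
  move=> Pz Pu; rewrite [u == z]eq_sym; suff -> : (z == u) = false by [].
  by apply/negP => /eqP E; rewrite -E Pz in Pu.
have aw : a \notin w by apply: contra aP => /Pw.
have xw : x \notin w by apply: contra xP => /Pw.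
have bw : b \notin w by apply: contra bP => /Pw.
apply: (@rep_extend P).
  by rewrite /= nPa nPb nPx Pq !filter_id // => z; rewrite -Ps.
move=> u v /= /or4P[/andP[/eqP<-]|/andP[/eqP<-]|/andP[/eqP<-]|].
- rewrite !inE !eqxx /= [b == a]eq_sym [x == a]eq_sym (negPf ax) (negPf ab) /=.
  rewrite (neq q a) ?nPa //= before_notl // orbF.
  case/or3P=> [/eqP->|/eqP->|]; rewrite ?(negPf eax) ?eqxx // -?Ps.
    by rewrite eab eq_sym (negPf xb) (negPf bw).
  move=> Pv _; rewrite ea // (neq v x) ?nPx //=.
  by case: eqP => [->|/eqP vq]; rewrite ?(negPf qw) ?wP.
- rewrite !inE !eqxx /= [b == x]eq_sym (negPf xb) (negPf ax) (neq q x) ?nPx //=.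
  rewrite before_notl // orbF => /orP[/eqP->|]; first by rewrite exb bw.
  rewrite -Ps => Pv _; rewrite ex //.
  by case: eqP => [->|/eqP vq]; rewrite ?(negPf qw) ?wP.
- rewrite -Ps !inE eqxx => Pv _; rewrite eb //.
  by case: (eqVneq v q) => //= vq; rewrite wP ?orbT.
by move=> /before_mem/andP[]; rewrite -!Ps => -> ->.
Qed.

(** A new square forming a component of its own: since [split_graph] does not record connectedness,
    the induction meets this case as well. *)
Lemma rep_disjoint (P : pred T) s w a x b y :
  P =i s -> P =i w ->
  a \notin P -> x \notin P -> b \notin P -> y \notin P -> uniq [:: a; x; b; y] ->
  e a b -> e x b -> e a y -> e x y -> ~~ e a x -> ~~ e b y ->
  {in P, forall v, [/\ e a v = false, e x v = false, e b v = false & e y v = false]} ->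
  rep s w -> rep [:: a, x, b, y & s] [:: b, y, a, x & w].
Proof.
move=> Ms Mw aP xP bP yP Un eab exb eay exy eax eby eP R.
have Ps z : P z = (z \in s) by exact: Ms.
have Pw z : P z = (z \in w) by exact: Mw.
have nPa : P a = false := negPf aP.
have nPx : P x = false := negPf xP.
have nPb : P b = false := negPf bP.
have nPy : P y = false := negPf yP.
move: Un; rewrite /= !inE !negb_or !andbT => /and3P[/and3P[ax ab ay] /andP[xb xy] yb].
have sy (u v : T) : (u != v) -> (v == u = false) by rewrite eq_sym => /negPf.
apply: (@rep_extend P).
  by rewrite /= nPa nPb nPx nPy !filter_id // => z; rewrite -?Ps -?Pw.
move=> u v /= /or4P[/andP[/eqP<-]|/andP[/eqP<-]|/andP[/eqP<-]|].
- rewrite !inE !eqxx /= (sy a b) // (sy a y) // (sy a x) //= before_notl -?Pw ?nPa //= orbF.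
  case/or4P=> [/eqP->|/eqP->|/eqP->|]; rewrite ?(negPf eax) ?eqxx // ?eab ?eay.
  + by rewrite (sy x b) // nPb.
  + by rewrite (sy x y) // nPy.
  + by rewrite -Ps => Pv _; case: (eP v Pv) => -> *; rewrite Pv orbT.
- rewrite !inE !eqxx /= (sy x b) // (sy x y) // (negPf ax) //= before_notl -?Pw ?nPx //= orbF.
  case/or3P=> [/eqP->|/eqP->|]; rewrite ?exb ?exy ?nPb ?nPy //.
  by rewrite -Ps => Pv _; case: (eP v Pv) => _ -> *; rewrite Pv.
- rewrite !inE eqxx /= => /orP[/eqP->|]; first by rewrite (negPf eby) eqxx.
  by rewrite -Ps => Pv _; case: (eP v Pv) => _ _ -> *; rewrite -Pw Pv !orbT.
case/orP=> [/andP[/eqP<-]|/before_mem/andP[]]; rewrite -!Ps; last by move=> -> ->.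
by move=> Pv _; rewrite !inE eqxx -Pw Pv !orbT /= ?orbT; case: (eP v Pv) => _ _ _ ->.
Qed.

(* Doubling the letter [b] at a turn about [y]: only [y] newly precedes [b], and [b] has the
   smaller label. *)
Lemma rep_double_high a x b y t w :
  uniq [:: a, x, b & t] -> y \in t ->
  rep [:: a, x, b & t] [:: b, y, a & w] -> rep [:: a, x, b & t] [:: b, y, b, a & w].
Proof.
move=> Un yt R u v uv; rewrite (R u v uv); congr (~~ _).
have [vb|vb] := eqVneq v b.
  have {uv} : (u == a) || (u == x).
    move: uv Un; rewrite vb /= !inE => uv /and4P[_ _ bt _]; move: uv.
    case/or4P=> [/andP[/eqP<-]|/andP[/eqP<-]|/andP[_]|/before_mem/andP[_]];
      by rewrite ?eqxx ?orbT ?(negPf bt).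
  move=> uax /=; suff [-> ->] : (b == u) = false /\ (y == u) = false.
    by [].
  move: Un; rewrite /= !inE !negb_or => /and4P[/and3P[ax ab nt] /andP[xb xt] bt _].
  by split; apply/negP => /eqP E; move: uax; rewrite -E => /orP[] /eqP F;
    move: ab xb nt xt; rewrite -F ?eqxx ?yt.
rewrite /= !inE (negPf vb) /=.
by case: (b == u) => //=; case: (v == y) => //=; case: (v == a) => //=; case: (v \in w); rewrite ?orbT.
Qed.

(* Doubling the letter [a] at a turn about [x]: [a] is moved above [x] in the labelling, and its
   new copy stands after [x]. *)
Lemma rep_double_low a x b t m w :
  uniq [:: a, x, b & t] -> a \in m -> ~~ e x a ->
  rep [:: a, x, b & t] (m ++ x :: w) -> rep [:: x, a, b & t] (m ++ [:: x, a & w]).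
Proof.
move=> Un am exa R u v.
have [ax ab nt xa] : [/\ a != x, a != b, a \notin t & x != a].
  by move: Un; rewrite [x == a]eq_sym /= !inE !negb_or => /andP[/and3P[-> -> ->]].
have [va|va] := eqVneq v a.
  rewrite va /= !inE eqxx (negPf nt) (negPf ab) /= !andbF /= before_notr // andbT orbF.
  move=> /eqP<-; rewrite (negPf exa) before_cat /= eqxx mem_head.
  by rewrite !orbT.
move=> uv.
have uv' : before [:: a, x, b & t] u v.
  move: uv; rewrite /= !inE (negPf va) /=.
  case/or4P=> [->|/andP[-> ->]|->|->]; rewrite ?orbT //.
rewrite (R u v uv') !before_cat /= !inE (negPf va) /=.
congr (~~ _); case: (boolP (u \in m)) => um /=.
  by case: (v == x) => //=; case: (v \in w); rewrite ?orbT ?andbF //=; case: (a == u); case: (x == u); rewrite ?orbF.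
by case: (a =P u) um => [<-|_ _] //; rewrite am.
Qed.

End Words.

Local Open Scope fset_scope.
Local Open Scope ring_scope.

(** * Coordinates on the grid *)

(* Affine isometries of the grid, in coordinates. *)
Definition frame (g : int -> int -> gpoint) : Prop :=
  exists o1 o2 p q r s : int,
    (((p = 1 \/ p = -1) /\ (s = 1 \/ s = -1) /\ q = 0 /\ r = 0) \/
     ((q = 1 \/ q = -1) /\ (r = 1 \/ r = -1) /\ p = 0 /\ s = 0)) /\
    forall i j, g i j = (o1 + p * i + q * j, o2 + r * i + s * j).

Lemma grid_adjP (u v : gpoint) :
  reflect ((u.1 = v.1 /\ (u.2 = v.2 + 1 \/ u.2 = v.2 - 1)) \/
           (u.2 = v.2 /\ (u.1 = v.1 + 1 \/ u.1 = v.1 - 1)))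
          (grid_adj u v).
Proof. by apply: (iffP eqP); case: u v => [u1 u2] [v1 v2] /=; nia. Qed.

Lemma grid_adj_sym : symmetric grid_adj.
Proof. by move=> u v; apply/grid_adjP/grid_adjP; lia. Qed.

(* A computable form of [grid_adj], which is made opaque below: unfolding it on non-closed
   integers makes failing conversion tests diverge. *)
Definition coord_adj (u v : int * int) : bool :=
  (u.1 == v.1) && ((u.2 == v.2 + 1) || (v.2 == u.2 + 1)) ||
  (u.2 == v.2) && ((u.1 == v.1 + 1) || (v.1 == u.1 + 1)).

Lemma frame_adj g : frame g ->
  forall i j k l, grid_adj (g i j) (g k l) = coord_adj (i, j) (k, l).
Proof.
move=> [o1 [o2 [p [q [r [s [C E]]]]]]] i j k l; rewrite !E.
move: C => [[[] -> [[] -> [-> ->]]]|[[] -> [[] -> [-> ->]]]];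
 apply/grid_adjP/idP; rewrite /coord_adj /=; lia.
Qed.

Local Opaque grid_adj.

Lemma frame_inj g : frame g -> forall i j k l, (g i j == g k l) = (i == k) && (j == l).
Proof.
move=> [o1 [o2 [p [q [r [s [C E]]]]]]] i j k l; rewrite !E xpair_eqE.
move: C => [[[] -> [[] -> [-> ->]]]|[[] -> [[] -> [-> ->]]]]; lia.
Qed.

(** The shifted coordinates are given through equations so that, at concrete arguments, the
    conclusion shows numerals and [erefl] discharges the equations. *)
Lemma frame_nbr g : frame g -> forall i j v, grid_adj (g i j) v ->
  forall i1 i2 j1 j2, i + 1 = i1 -> i - 1 = i2 -> j + 1 = j1 -> j - 1 = j2 ->
  [\/ v = g i1 j, v = g i2 j, v = g i j1 | v = g i j2].
Proof.
move=> [o1 [o2 [p [q [r [s [C E]]]]]]] i j [v1 v2] A _ _ _ _ <- <- <- <-; rewrite !E.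
move: A => /grid_adjP; rewrite E /=.
have pe (a b a' b' : int) : a = a' -> b = b' -> (a, b) = (a', b') by move=> -> ->.
move: C => [[[] -> [[] -> [-> ->]]]|[[] -> [[] -> [-> ->]]]] A;
case: A => [[A []]|[A []]] B;
first [constructor 1; apply: pe; lia | constructor 2; apply: pe; lia
      |constructor 3; apply: pe; lia | constructor 4; apply: pe; lia].
Qed.

(** [h1] and [h2] enter only through their affine values, so a reindexed frame keeps a short form
    such as [g (1 - i) j]. In [remap] the offsets [a b] come first, then the matrix row by row. *)
Lemma frame_remap g h1 h2 a b p q r s : frame g ->
  (((p = 1 \/ p = -1) /\ (s = 1 \/ s = -1) /\ q = 0 /\ r = 0) \/
   ((q = 1 \/ q = -1) /\ (r = 1 \/ r = -1) /\ p = 0 /\ s = 0)) ->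
  (forall i j, h1 i j = a + p * i + q * j) ->
  (forall i j, h2 i j = b + r * i + s * j) ->
  frame (fun i j => g (h1 i j) (h2 i j)).
Proof.
move=> [o1 [o2 [p' [q' [r' [s' [C' E]]]]]]] C E1 E2.
exists (o1 + p' * a + q' * b), (o2 + r' * a + s' * b),
  (p' * p + q' * r), (p' * q + q' * s), (r' * p + s' * r), (r' * q + s' * s).
split; last by move=> i j; rewrite E E1 E2; congr (_, _); lia.
move: C C' {E E1 E2}.
by case=> [[[] -> [[] -> [-> ->]]]|[[] -> [[] -> [-> ->]]]];
  case=> [[[] -> [[] -> [-> ->]]]|[[] -> [[] -> [-> ->]]]]; lia.
Qed.

Tactic Notation "remap" constr(F) uconstr(a) uconstr(b) uconstr(p) uconstr(q)
    uconstr(r) uconstr(s) :=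
  refine (@frame_remap _ _ _ a b p q r s F _ _ _); clear; lia.

Lemma frame_flip (g : int -> int -> gpoint) : frame g -> frame (fun i j => g i (- j)).
Proof. by move=> F; remap F 0 0 1 0 0 (-1). Qed.

Lemma frame_swap (g : int -> int -> gpoint) : frame g -> frame (fun i j => g j i).
Proof. by move=> F; remap F 0 0 0 1 1 0. Qed.

Lemma frame_edge u v : grid_adj u v -> exists g, [/\ frame g, g 0 0 = u & g 1 0 = v].
Proof.
case: u v => [u1 u2] [v1 v2] /grid_adjP /=.
have pe (a b a' b' : int) : a = a' -> b = b' -> (a, b) = (a', b') by move=> -> ->.
case=> [[E1 [E2|E2]]|[E1 [E2|E2]]].
- exists (fun i j => (u1 + 0 * i + 1 * j, u2 + (-1) * i + 0 * j)); split; try (apply: pe; lia).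
  by exists u1, u2, 0, 1, (-1), 0; split=> //; lia.
- exists (fun i j => (u1 + 0 * i + 1 * j, u2 + 1 * i + 0 * j)); split; try (apply: pe; lia).
  by exists u1, u2, 0, 1, 1, 0; split=> //; lia.
- exists (fun i j => (u1 + (-1) * i + 0 * j, u2 + 0 * i + 1 * j)); split; try (apply: pe; lia).
  by exists u1, u2, (-1), 0, 0, 1; split=> //; lia.
- exists (fun i j => (u1 + 1 * i + 0 * j, u2 + 0 * i + 1 * j)); split; try (apply: pe; lia).
  by exists u1, u2, 1, 0, 0, 1; split=> //; lia.
Qed.

(** * The least high vertex and the free edge at it *)

Section LowHigh.

Variables (c : pred gpoint) (f : gpoint -> nat).

Local Notation "u <f v" := (leq (S (f u)) (f v)) (at level 70, only parsing).

(* What survives of a 12-representation, in a form inherited by subgraphs: [c] selects the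
   low end of every edge, and edges inducing a matching span disjoint intervals of labels. *)
Record split_graph (V : {fset gpoint}) : Prop := SplitGraph {
  sg_col : forall u v, u \in V -> v \in V -> grid_adj u v -> c v = ~~ c u;
  sg_ord : forall u v, u \in V -> v \in V -> grid_adj u v -> c u -> u <f v;
  sg_ind : forall a1 b1 a2 b2, [&& a1 \in V, b1 \in V, a2 \in V & b2 \in V] ->
     c a1 -> c a2 -> grid_adj a1 b1 -> grid_adj a2 b2 ->
     a1 <f b2 -> a2 <f b1 -> grid_adj a1 b2 || grid_adj a2 b1;
  sg_vtx : forall u, u \in V -> exists2 v, v \in V & grid_adj u v;
  sg_edge : forall g, frame g -> g 0 0 \in V -> g 1 0 \in V ->
     (g 0 1 \in V) && (g 1 1 \in V) || (g 0 (-1) \in V) && (g 1 (-1) \in V) }.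

Definition least_high (V : {fset gpoint}) (b : gpoint) : Prop :=
  [/\ b \in V, ~~ c b & forall b', b' \in V -> ~~ c b' -> (f b <= f b')%N].

(** The four excluded points are the remaining grid neighbours of [g 0 0] and [g 1 0], so both ends
    of this edge have degree two. *)
Definition free_edge (V : {fset gpoint}) (g : int -> int -> gpoint) : Prop :=
  [/\ frame g, c (g 0 0),
      [&& g 0 0 \in V, g 1 0 \in V, g 1 1 \in V & g 0 1 \in V] &
      [&& g (-1) 0 \notin V, g 0 (-1) \notin V, g 1 (-1) \notin V & g 2 0 \notin V]].

Section Least.

Variables (V : {fset gpoint}) (b : gpoint).
Hypotheses (HV : split_graph V) (Hb : least_high V b).

Lemma low_nbr_least v : v \in V -> grid_adj b v -> c v /\ v <f b.
Proof.
case: Hb => bV cb _ vV bv; have cv : c v by rewrite (sg_col HV bV vV bv).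
by split=> //; apply: (sg_ord HV) => //; rewrite grid_adj_sym.
Qed.

(** No high vertex has a label below [f b], so the label intervals of two edges whose low ends lie
    below [b] both contain [f b], and [sg_ind] applies. *)
Lemma least_overlap a1 b1 a2 b2 : a1 \in V -> b1 \in V -> a2 \in V -> b2 \in V ->
  c a1 -> c a2 -> a1 <f b -> a2 <f b ->
  grid_adj a1 b1 -> grid_adj a2 b2 -> grid_adj a1 b2 || grid_adj a2 b1.
Proof.
case: Hb => bV cb mb a1V b1V a2V b2V c1 c2 l1 l2 e1 e2.
apply: (sg_ind HV _ c1 c2 e1 e2); first exact/and4P.
  by apply: leq_trans l1 _; apply: mb => //; rewrite (sg_col HV a2V b2V e2) negbK.
by apply: leq_trans l2 _; apply: mb => //; rewrite (sg_col HV a1V b1V e1) negbK.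
Qed.

(** A square on each of the two edges gives each opposite neighbour of [b] a further high neighbour
    that is not adjacent to the other one. This contradicts [least_overlap]. *)
Lemma least_no_opposite g : frame g -> g 0 0 = b -> g 1 0 \in V -> g (-1) 0 \in V -> False.
Proof.
move=> F gb r l; have bV : b \in V by case: Hb.
have F' : frame (fun i j => g (- i) j) by remap F 0 0 (-1) 0 0 1.
have adj0 i j : coord_adj (0, 0) (i, j) -> g i j \in V -> c (g i j) /\ (g i j) <f b.
  by move=> A gV; apply: low_nbr_least => //; rewrite -gb frame_adj.
have [cr lr] : c (g 1 0) /\ (g 1 0) <f b by exact: adj0.
have [cl ll] : c (g (-1) 0) /\ (g (-1) 0) <f b by exact: adj0.
have [p pV Ap] : exists2 j, g 1 j \in V & coord_adj (1, 0) (1, j) && ~~ coord_adj (-1, 0) (1, j).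
  have := sg_edge HV F; rewrite gb => /(_ bV r) /orP[/andP[_ h]|/andP[_ h]].
    by exists 1.
  by exists (-1).
have [q qV Aq] : exists2 j, g (-1) j \in V & coord_adj (-1, 0) (-1, j) && ~~ coord_adj (1, 0) (-1, j).
  have := sg_edge HV F'; rewrite /= oppr0 gb => /(_ bV l) /orP[/andP[_ h]|/andP[_ h]].
    by exists 1.
  by exists (-1).
case/andP: Ap => Ap Ap'; case/andP: Aq => Aq Aq'.
have := least_overlap r pV l qV cr cl lr ll; rewrite !(frame_adj F) => /(_ Ap Aq).
by rewrite (negPf Ap') (negPf Aq').
Qed.

(** Apart from [b] and [g 1 1], the points [g 1 0] and [g 0 1] have no common neighbour, so their
    extra edges would induce a matching although both low ends lie below [b]. *)
Lemma least_two_extra g p q : frame g -> g 0 0 = b -> g 1 0 \in V -> g 0 1 \in V ->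
  p \in V -> grid_adj (g 1 0) p -> p != b -> p != g 1 1 ->
  q \in V -> grid_adj (g 0 1) q -> q != b -> q != g 1 1 -> False.
Proof.
move=> F gb r l pV rp pb p11 qV lq qb q11.
have adj0 i j : coord_adj (0, 0) (i, j) -> g i j \in V -> c (g i j) /\ (g i j) <f b.
  by move=> A gV; apply: low_nbr_least => //; rewrite -gb frame_adj.
have [cr lr] : c (g 1 0) /\ (g 1 0) <f b by exact: adj0.
have [cl ll] : c (g 0 1) /\ (g 0 1) <f b by exact: adj0.
have := least_overlap r pV l qV cr cl lr ll rp lq.
have [E|E|E|E] := frame_nbr F rp (i1 := 2) (i2 := 0) (j1 := 1) (j2 := -1) erefl erefl erefl erefl;
have [E'|E'|E'|E'] := frame_nbr F lq (i1 := 1) (i2 := -1) (j1 := 2) (j2 := 0) erefl erefl erefl erefl;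
by rewrite ?E ?E' ?gb ?eqxx in pb p11 qb q11 *; rewrite ?(frame_adj F).
Qed.

Lemma low_square_at u : u \in V ->
  exists g, [/\ frame g, g 0 0 = u & [&& g 1 0 \in V, g 0 1 \in V & g 1 1 \in V]].
Proof.
move=> uV; have [v vV uv] := sg_vtx HV uV; have [g [F g0 g1]] := frame_edge uv.
have := sg_edge HV F; rewrite g0 g1 => /(_ uV vV) /orP[] /andP[h1 h2].
  by exists g; rewrite g0 g1 vV h1 h2.
by exists (fun i j => g i (- j)); rewrite oppr0 g0 g1 vV h1 h2; split=> //; apply: frame_flip.
Qed.

(** If [a] is not adjacent to [b], comparing an edge [a p] with the edges from [b] to its two
    neighbours makes [p] adjacent to both, so [p] is the fourth point [g 1 1] of their square. Then
    [a] has only one neighbour, although it lies in a square. *)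
Lemma below_least_adj a : a \in V -> c a -> a <f b -> grid_adj a b.
Proof.
move=> aV ca lab; apply/negPn/negP => nab; have bV : b \in V by case: Hb.
have [g [F gb /and3P[g10 g01 _]]] := low_square_at bV.
have [h [F' ha /and3P[h10 h01 _]]] := low_square_at aV.
have common p : p \in V -> grid_adj a p -> p = g 1 1.
  move=> pV ap.
  have A i j : coord_adj (0, 0) (i, j) -> g i j \in V -> grid_adj (g i j) p.
    move=> A gV; have bg : grid_adj b (g i j) by rewrite -gb frame_adj.
    have [cg lg] := low_nbr_least gV bg.
    have := least_overlap aV pV gV bV ca cg lab lg ap.
    by rewrite grid_adj_sym (negPf nab) /=; apply.
  have A1 : grid_adj (g 1 0) p by exact: A.
  have A2 : grid_adj (g 0 1) p by exact: A.
  have [E|E|E|E] := frame_nbr F A1 (i1 := 2) (i2 := 0) (j1 := 1) (j2 := -1) erefl erefl erefl erefl => //;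
    move: A2; rewrite E ?(frame_adj F) //.
  by move: ap nab; rewrite E gb => ->.
have A1 : grid_adj a (h 1 0) by rewrite -ha (frame_adj F').
have A2 : grid_adj a (h 0 1) by rewrite -ha (frame_adj F').
have E : h 1 0 = h 0 1 by rewrite (common _ h10 A1) (common _ h01 A2).
by have := frame_inj F' 1 0 0 1; rewrite E eqxx.
Qed.

(** By [least_no_opposite] exactly two perpendicular neighbours of [b] are present, and by
    [least_two_extra] one of them has degree two; the edge from it to [b] is free. *)
Lemma least_free_edge : exists g, free_edge V g /\ g 1 0 = b.
Proof.
have bV : b \in V by case: Hb.
have [g [F gb /and3P[g10 g01 g11]]] := low_square_at bV.
suff [h [F' h0 [h1 h2 h3] [n1 n2]]] : exists h, [/\ frame h, h 0 0 = b,
    [/\ h 1 0 \in V, h 0 1 \in V & h 1 1 \in V] & h 2 0 \notin V /\ h 1 (-1) \notin V].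
  (* Reflection moves the low end of the edge to the origin and [b] to [(1, 0)]. *)
  have F'' : frame (fun i j => h (1 - i) j).
    by remap F' 1 0 (-1) 0 0 1.
  exists (fun i j => h (1 - i) j); split=> //; split=> //.
  - by have [] := @low_nbr_least (h 1 0) h1; rewrite // -h0 (frame_adj F').
  - by apply/and4P; split=> //; move: bV; rewrite -h0.
  - apply/and4P; split=> //.
    + by apply/negP => H; apply: (least_no_opposite (frame_swap F') h0 h2 H).
    + by apply/negP => H; apply: (least_no_opposite F' h0 h1 H).
have [|/norP[]] := boolP ((g 2 0 \in V) || (g 1 (-1) \in V)); last by exists g.
have [|/norP[]] := boolP ((g 0 2 \in V) || (g (-1) 1 \in V)); last first.
  by exists (fun i j => g j i); split=> //; apply: frame_swap.
have dif i j k l : ~~ ((i == k) && (j == l)) -> g i j != g k l by rewrite (frame_inj F).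
move=> Q P; have [p [pV rp pb p11]] : exists p, [/\ p \in V, grid_adj (g 1 0) p, p != g 0 0 & p != g 1 1].
  by case/orP: P => H; [exists (g 2 0) | exists (g 1 (-1))]; split=> //; rewrite ?frame_adj ?dif.
have [q [qV lq qb q11]] : exists q, [/\ q \in V, grid_adj (g 0 1) q, q != g 0 0 & q != g 1 1].
  by case/orP: Q => H; [exists (g 0 2) | exists (g (-1) 1)]; split=> //; rewrite ?frame_adj ?dif.
by rewrite gb in pb qb; case: (least_two_extra F gb g10 g01 pV rp pb p11 qV lq qb q11).
Qed.

End Least.

End LowHigh.

(** * Corners and removal of an end *)

(** Frames commute with point reflections: agreement at two points gives agreement at the reflection
    of the second in the first. This identifies the points on the far side of a removed square. *)
Lemma frame_opposite g h i j k l i' j' k' l' m n m' n' : frame g -> frame h ->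
  h i j = g i' j' -> h k l = g k' l' ->
  m = i + i - k -> n = j + j - l -> m' = i' + i' - k' -> n' = j' + j' - l' ->
  h m n = g m' n'.
Proof.
move=> [o1 [o2 [p [q [r [s [_ E]]]]]]] [O1 [O2 [P [Q [R [S [_ E']]]]]]].
rewrite !E !E' => -[A1 A2] [B1 B2] -> -> -> ->; congr (_, _); lia.
Qed.

Definition corner_frame (V : {fset gpoint}) (g : int -> int -> gpoint) : Prop :=
  [/\ frame g, g 0 0 \in V,
    (g (-1) 0 \notin V) && (g 0 (-1) \notin V) &
    [&& g 1 0 \in V, g 0 1 \in V, g 1 1 \in V, g 2 0 \in V, g 2 1 \in V,
        g 0 2 \in V & g 1 2 \in V]].

(* In a square grid graph these are the corner nodes; see [corner_node_corner]. *)
Definition corner (V : {fset gpoint}) (u : gpoint) : Prop :=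
  exists2 g, corner_frame V g & g 0 0 = u.

Lemma corner_frame_swap V g : corner_frame V g -> corner_frame V (fun i j => g j i).
Proof.
case=> F h1 /andP[h2 h3] /and4P[h4 h5 h6 /and4P[h7 h8 h9 h10]].
split=> //; first exact: frame_swap.
  by rewrite h2 h3.
by rewrite h4 h5 h6 h7 h8 h9 h10.
Qed.

Definition three_nbrs (V : {fset gpoint}) (v : gpoint) : Prop :=
  exists v1 v2 v3, [/\ uniq [:: v1; v2; v3], [&& v1 \in V, v2 \in V & v3 \in V] &
    [&& grid_adj v v1, grid_adj v v2 & grid_adj v v3]].

Lemma two_not_three V v p q :
  (forall u, u \in V -> grid_adj v u -> u = p \/ u = q) -> ~ three_nbrs V v.
Proof.
move=> H [v1 [v2 [v3 [Un /and3P[h1 h2 h3] /and3P[e1 e2 e3]]]]].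
move: Un; case: (H _ h1 e1) => ->; case: (H _ h2 e2) => ->; case: (H _ h3 e3) => ->;
  by rewrite /= !inE !eqxx ?orbT ?andbF.
Qed.

(** Removed vertices have degree two, so the other three vertices of the corner's square are never
    removed. *)
Lemma corner_frame_three V g : corner_frame V g ->
  [/\ three_nbrs V (g 1 0), three_nbrs V (g 0 1) & three_nbrs V (g 1 1)].
Proof.
case=> F h1 /andP[h2 h3] /and4P[h4 h5 h6 /and4P[h7 h8 h9 h10]]; split.
- exists (g 0 0), (g 2 0), (g 1 1); rewrite !(frame_adj F) h1 h7 h6 /= !inE !(frame_inj F).
  by split.
- exists (g 0 0), (g 0 2), (g 1 1); rewrite !(frame_adj F) h1 h9 h6 /= !inE !(frame_inj F).
  by split.
- exists (g 1 0), (g 0 1), (g 2 1); rewrite !(frame_adj F) h4 h5 h8 /= !inE !(frame_inj F).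
  by split.
Qed.

Lemma corner_nbr V u v : corner V u -> v \in V -> grid_adj u v -> three_nbrs V v.
Proof.
case=> g cg <- vV uv; have [t1 t2 _] := corner_frame_three cg.
case: cg => F _ /andP[n1 n2] _.
have [E|E|E|E] := frame_nbr F uv (i1 := 1) (i2 := -1) (j1 := 1) (j2 := -1) erefl erefl erefl erefl;
  rewrite E // in vV *.
- by rewrite vV in n1.
- by rewrite vV in n2.
Qed.

Section LowHigh.

Variables (c : pred gpoint) (f : gpoint -> nat).

Section Free.

Variables (V : {fset gpoint}) (g : int -> int -> gpoint).
Hypothesis (FE : free_edge c V g).

Lemma free_nbr00 v : v \in V -> grid_adj (g 0 0) v -> v = g 1 0 \/ v = g 0 1.
Proof.
case: FE => F _ _ /and4P[n1 n2 n3 n4] vV uv.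
have [E|E|E|E] := frame_nbr F uv (i1 := 1) (i2 := -1) (j1 := 1) (j2 := -1) erefl erefl erefl erefl; auto.
  by rewrite -E vV in n1.
by rewrite -E vV in n2.
Qed.

Lemma free_nbr10 v : v \in V -> grid_adj (g 1 0) v -> v = g 0 0 \/ v = g 1 1.
Proof.
case: FE => F _ _ /and4P[n1 n2 n3 n4] vV uv.
have [E|E|E|E] := frame_nbr F uv (i1 := 2) (i2 := 0) (j1 := 1) (j2 := -1) erefl erefl erefl erefl; auto.
  by rewrite -E vV in n4.
by rewrite -E vV in n3.
Qed.

Lemma free_not_corner :
  [/\ ~ corner V (g 0 0), ~ corner V (g 1 0), ~ corner V (g 1 1) & ~ corner V (g 0 1)].
Proof.
have n0 := two_not_three free_nbr00; have n1 := two_not_three free_nbr10.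
case: FE => F _ /and4P[h1 h2 h3 h4] _.
by split=> /corner_nbr H; [apply: n1|apply: n0|apply: n1|apply: n0]; apply: H => //; rewrite frame_adj.
Qed.

End Free.

(** The conditions on colours and labels pass to subsets, so only [sg_vtx] and [sg_edge] are
    rechecked. Flipping [h] reduces the latter to an old square on the positive side. *)
Lemma split_remove (V N : {fset gpoint}) : split_graph c f V ->
  (forall h, frame h -> h 0 0 \in V `\` N -> h 1 0 \in V `\` N ->
     h 0 1 \in V -> h 1 1 \in V ->
     (h 0 1 \in V `\` N) && (h 1 1 \in V `\` N) ||
     (h 0 (-1) \in V `\` N) && (h 1 (-1) \in V `\` N)) ->
  (forall u, u \in V `\` N -> exists2 v, v \in V `\` N & grid_adj u v) ->
  split_graph c f (V `\` N).
Proof.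
move=> HV HE HX; have sub u : u \in V `\` N -> u \in V by rewrite inE => /andP[].
split=> //.
- by move=> u v /sub uV /sub vV; apply: (sg_col HV).
- by move=> u v /sub uV /sub vV; apply: (sg_ord HV).
- move=> a1 b1 a2 b2 /and4P[/sub h1 /sub h2 /sub h3 /sub h4]; apply: (sg_ind HV); exact/and4P.
- move=> h F h0 h1; have /orP[/andP[h2 h3]|/andP[h2 h3]] := sg_edge HV F (sub _ h0) (sub _ h1).
    exact: HE.
  have := HE _ (frame_flip F); rewrite /= !oppr0 !opprK => /(_ h0 h1 h2 h3).
  by rewrite orbC.
Qed.

Definition square_closed (V N : {fset gpoint}) : Prop :=
  forall h, frame h -> h 0 0 \in V `\` N -> h 1 0 \in V `\` N ->
     h 0 1 \in V -> h 1 1 \in V -> (h 0 1 \in V `\` N) && (h 1 1 \in V `\` N).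

(** Only the absence of two neighbours can fail in the larger graph, and a point that fails it would
    be an element of [N] adjacent to [u]. *)
Lemma corner_grow (V N : {fset gpoint}) u : corner (V `\` N) u ->
  {in N, forall v, ~~ grid_adj u v} -> corner V u.
Proof.
case=> h [F h0 /andP[n1 n2] L] <- H; exists h => //.
have sub v : v \in V `\` N -> v \in V by rewrite inE => /andP[].
move/and4P: L => [/sub h4 /sub h5 /sub h6 /and4P[/sub h7 /sub h8 /sub h9 /sub h10]].
split=> //; [exact: sub| |by rewrite h4 h5 h6 h7 h8 h9 h10].
move: n1 n2; rewrite !inE !negb_and !negbK => n1 n2; apply/andP; split.
  by case/orP: n1 => // /H; rewrite (frame_adj F).
by case/orP: n2 => // /H; rewrite (frame_adj F).
Qed.

(** The vertices with three neighbours survive by hypothesis; each of the two adjacent squares thus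
    keeps an edge, and [square_closed] keeps it whole. *)
Lemma corner_shrink (V N : {fset gpoint}) u : square_closed V N ->
  {in N, forall v, ~ three_nbrs V v} -> u \in V `\` N -> corner V u ->
  corner (V `\` N) u.
Proof.
move=> SC N3 uV [h ch hu]; exists h => //.
have [t1 t2 t3] := corner_frame_three ch.
have F : frame h by case: ch.
have Fa : frame (fun i j => h (1 + j) i) by remap F 1 0 0 1 1 0.
have Fb : frame (fun i j => h i (1 + j)) by remap F 0 1 1 0 0 1.
case: ch => _ h0 /andP[n1 n2] /and4P[h4 h5 h6 /and4P[h7 h8 h9 h10]].
have out v : v \in V -> three_nbrs V v -> v \in V `\` N.
  by move=> vV tv; rewrite inE vV andbT; apply/negP => /N3; apply.
have o4 := out _ h4 t1; have o5 := out _ h5 t2; have o6 := out _ h6 t3.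
have /andP[o7 o8] := SC _ Fa o4 o6 h7 h8.
have /andP[o9 o10] := SC _ Fb o5 o6 h9 h10.
split=> //; first by rewrite hu.
  by rewrite !inE !negb_and n1 n2 !orbT.
by apply/and4P; split=> //; apply/and4P; split.
Qed.

(** A square hanging on its vertex [s], with [n0] opposite to [s]. The only survivor that can be
    adjacent to [N] is [s], so a square that loses a vertex keeps no edge. *)
Lemma pendant_square_closed (V N : {fset gpoint}) n0 n1 n2 s :
  N =i [:: n0; n1; n2] ->
  (forall v, v \in V -> grid_adj n0 v -> v = n1 \/ v = n2) ->
  (forall v, v \in V -> grid_adj n1 v -> v = n0 \/ v = s) ->
  (forall v, v \in V -> grid_adj n2 v -> v = n0 \/ v = s) ->
  square_closed V N.
Proof.
move=> EN N0 N1 N2.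
have sub v : v \in V `\` N -> v \in V by rewrite inE => /andP[].
have key h : frame h -> h 0 0 \in V `\` N -> h 1 0 \in V `\` N ->
     h 0 1 \in V -> h 1 1 \in V -> h 0 1 \notin N.
  move=> F h0 h1 h2 h3; apply/negP => hN.
  have A : grid_adj (h 0 1) (h 0 0) by rewrite frame_adj.
  have B : grid_adj (h 0 1) (h 1 1) by rewrite frame_adj.
  have C : grid_adj (h 1 1) (h 1 0) by rewrite frame_adj.
  have D : h 1 1 != h 0 0 by rewrite (frame_inj F).
  have i0 : n0 \in N by rewrite EN !inE eqxx.
  have i1 : n1 \in N by rewrite EN !inE eqxx !orbT.
  have i2 : n2 \in N by rewrite EN !inE eqxx !orbT.
  have no v : v \in V `\` N -> v \in N -> False by rewrite inE => /andP[/negPf->].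
  have [E|[E Es]] : h 1 1 = n0 \/ (h 1 1 = s /\ h 0 0 = s).
    move: hN; rewrite EN !inE => /or3P[] /eqP E; rewrite E in A B.
    - by case: (N0 _ (sub _ h0) A) => E'; case: (no _ h0); rewrite E'.
    - case: (N1 _ (sub _ h0) A) => E'; first by case: (no _ h0); rewrite E'.
      by case: (N1 _ h3 B); auto.
    - case: (N2 _ (sub _ h0) A) => E'; first by case: (no _ h0); rewrite E'.
      by case: (N2 _ h3 B); auto.
    by rewrite E in C; case: (N0 _ (sub _ h1) C) => E'; case: (no _ h1); rewrite E'.
  by rewrite E Es eqxx in D.
move=> h F h0 h1 h2 h3; rewrite !inE h2 h3 !andbT; apply/andP; split; first exact: (key h F h0 h1 h2 h3).
have F' : frame (fun i j => h (1 - i) j) by remap F 1 0 (-1) 0 0 1.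
exact: (key _ F' h1 h0 h3 h2).
Qed.

Lemma isolated_square_closed (V N : {fset gpoint}) :
  (forall u v, u \in N -> v \in V -> grid_adj u v -> v \in N) -> square_closed V N.
Proof.
move=> H h F; rewrite !inE => /andP[n0 h0] /andP[n1 h1] h2 h3; rewrite h2 h3 !andbT.
by apply/andP; split; [apply: contra n0|apply: contra n1] => hN; apply: (H _ _ hN) => //; rewrite frame_adj.
Qed.

Record core (V : {fset gpoint}) (s w : seq gpoint) : Prop := Core {
  core_uniq : uniq s;
  core_s : s =i V;
  core_w : w =i V;
  core_rep : rep grid_adj s w }.

Record good (V : {fset gpoint}) (s w : seq gpoint) : Prop := Good {
  good_core : core V s w;
  good_double : forall u, corner V u -> count_mem u w = 2%N /\ gap3 u w;
  good_single : forall u, u \in V -> ~ corner V u -> count_mem u w = 1%N }.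

Lemma count1_cat (T : eqType) (u : T) w1 w2 :
  count_mem u (w1 ++ w2) = 1%N -> u \in w1 -> u \notin w2.
Proof.
by rewrite count_cat -!has_pred1 !has_count => E h1; apply/negP => h2; lia.
Qed.

Lemma core_edge V N a b p q t m w : N =i [:: a; b] -> a \in V -> b \in V -> a != b ->
  grid_adj a b -> core (V `\` N) (p :: t) (m ++ q :: w) ->
  q \notin w -> {subset m <= w} ->
  {in V `\` N, forall v, grid_adj a v = (v == q)} ->
  {in V `\` N, forall v, grid_adj b v = (v == p)} ->
  core V [:: a, p, b & t] (b :: m ++ [:: q, a & w]).
Proof.
move=> EN aV bV ab eab [Un Ms Mw R] qw mw ea eb.
have an : a \notin V `\` N by rewrite !inE EN !inE eqxx.
have bn : b \notin V `\` N by rewrite !inE EN !inE eqxx orbT.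
have inV v : (v \in V) = [|| v == a, v == b | v \in V `\` N].
  rewrite !inE EN !inE; case: eqVneq => [->|_]; first by rewrite aV.
  by case: eqVneq => [->|_]; rewrite ?bV.
split.
- move: Un an bn; rewrite -!Ms /= !inE !negb_or [p == b]eq_sym.
  by move=> /andP[-> ->] /andP[-> ->] /andP[-> ->]; rewrite ab.
- move=> v; rewrite inV -Ms !inE.
  by case: (v == a); case: (v == b); case: (v == p); rewrite ?orbT.
- move=> v; rewrite inV -Mw !inE !mem_cat !inE.
  by case: (v == a); case: (v == b); case: (v \in m); case: (v == q); rewrite ?orbT.
- apply: (@rep_edge _ _ grid_adj_sym [pred v | v \in V `\` N]) => //.
  + by case/andP: Un.
Qed.

End LowHigh.

(** * Adding a square at the end *)

Lemma core_vertex_low V N a b y p t w : N =i [:: a; b; y] ->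
  [&& a \in V, b \in V & y \in V] -> uniq [:: a; b; y] ->
  grid_adj a b -> grid_adj a y -> ~~ grid_adj b y -> core (V `\` N) (p :: t) w ->
  {in V `\` N, forall v, grid_adj a v = false} ->
  {in V `\` N, forall v, grid_adj b v = (v == p)} ->
  {in V `\` N, forall v, grid_adj y v = (v == p)} ->
  core V [:: a, p, b, y & t] [:: b, y, a & w].
Proof.
move=> EN /and3P[aV bV yV] Un eab eay eby [Up Ms Mw R] ea eb ey.
have an : a \notin V `\` N by rewrite !inE EN !inE eqxx.
have bn : b \notin V `\` N by rewrite !inE EN !inE eqxx orbT.
have yn : y \notin V `\` N by rewrite !inE EN !inE eqxx !orbT.
have inV v : (v \in V) = [|| v == a, v == b, v == y | v \in V `\` N].
  rewrite !inE EN !inE; case: eqVneq => [->|_]; first by rewrite aV.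
  by case: eqVneq => [->|_]; rewrite ?bV //; case: eqVneq => [->|_]; rewrite ?yV.
split.
- move: Up Un an bn yn; rewrite -!Ms /= !inE !negb_or [p == b]eq_sym [p == y]eq_sym.
  by move=> /andP[-> ->] /and3P[/andP[-> ->] -> _] /andP[-> ->] /andP[-> ->] /andP[-> ->].
- move=> v; rewrite inV -Ms !inE.
  by case: (v == a); case: (v == b); case: (v == y); case: (v == p); rewrite ?orbT.
- move=> v; rewrite inV -Mw !inE.
  by case: (v == a); case: (v == b); case: (v == y); rewrite ?orbT.
- apply: (@rep_vertex_low _ _ grid_adj_sym [pred v | v \in V `\` N]) => //.
  + by case/andP: Up.
Qed.

Lemma core_vertex_high V N a x b s q w : N =i [:: b; a; x] ->
  [&& a \in V, x \in V & b \in V] -> uniq [:: a; x; b] ->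
  grid_adj a b -> grid_adj x b -> ~~ grid_adj a x -> core (V `\` N) s (q :: w) ->
  q \notin w ->
  {in V `\` N, forall v, grid_adj b v = false} ->
  {in V `\` N, forall v, grid_adj a v = (v == q)} ->
  {in V `\` N, forall v, grid_adj x v = (v == q)} ->
  core V [:: a, x, b & s] [:: b, q, a, x & w].
Proof.
move=> EN /and3P[aV xV bV] Un eab exb eax [Up Ms Mw R] qw eb ea ex.
have bn : b \notin V `\` N by rewrite !inE EN !inE eqxx.
have an : a \notin V `\` N by rewrite !inE EN !inE eqxx orbT.
have xn : x \notin V `\` N by rewrite !inE EN !inE eqxx !orbT.
have inV v : (v \in V) = [|| v == a, v == x, v == b | v \in V `\` N].
  rewrite !inE EN !inE; case: eqVneq => [->|_]; first by rewrite aV.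
  by case: eqVneq => [->|_]; rewrite ?xV //; case: eqVneq => [->|_]; rewrite ?bV.
split.
- move: Up Un an bn xn; rewrite -!Ms /= !inE !negb_or.
  by move=> -> /and3P[/andP[-> ->] -> _] -> -> ->.
- move=> v; rewrite inV -Ms !inE.
  by case: (v == a); case: (v == b); case: (v == x); rewrite ?orbT.
- move=> v; rewrite inV -Mw !inE.
  by case: (v == a); case: (v == b); case: (v == x); case: (v == q); rewrite ?orbT.
- by apply: (@rep_vertex_high _ grid_adj [pred v | v \in V `\` N]).
Qed.

Lemma core_disjoint V N a x b y s w : N =i [:: a; x; b; y] ->
  [&& a \in V, x \in V, b \in V & y \in V] -> uniq [:: a; x; b; y] ->
  grid_adj a b -> grid_adj x b -> grid_adj a y -> grid_adj x y ->
  ~~ grid_adj a x -> ~~ grid_adj b y -> core (V `\` N) s w ->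
  (forall u v, u \in N -> v \in V `\` N -> grid_adj u v = false) ->
  core V [:: a, x, b, y & s] [:: b, y, a, x & w].
Proof.
move=> EN /and4P[aV xV bV yV] Un eab exb eay exy eax eby [Up Ms Mw R] eN.
have aN : a \in N by rewrite EN !inE eqxx.
have xN : x \in N by rewrite EN !inE eqxx !orbT.
have bN : b \in N by rewrite EN !inE eqxx !orbT.
have yN : y \in N by rewrite EN !inE eqxx !orbT.
have notN v : v \in N -> v \notin V `\` N by rewrite inE => ->.
have inV v : (v \in V) = [|| v == a, v == x, v == b, v == y | v \in V `\` N].
  rewrite inE EN !inE; case: eqVneq => [->|_]; first by rewrite aV.
  case: eqVneq => [->|_]; first by rewrite xV.
  by case: eqVneq => [->|_]; rewrite ?bV //; case: eqVneq => [->|_]; rewrite ?yV.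
split.
- move: (notN _ aN) (notN _ xN) (notN _ bN) (notN _ yN) Un; rewrite -!Ms /= !inE !negb_or Up.
  by move=> -> -> -> -> /and4P[/and3P[-> -> ->] /andP[-> ->] ->].
- move=> v; rewrite inV -Ms !inE.
  by case: (v == a); case: (v == b); case: (v == x); rewrite ?orbT.
- move=> v; rewrite inV -Mw !inE.
  by case: (v == a); case: (v == b); case: (v == x); case: (v == y); rewrite ?orbT.
- apply: (@rep_disjoint _ grid_adj [pred v | v \in V `\` N]) => //; try exact: notN.
  by move=> v vV; split; apply: eN.
Qed.

(** Used when the new square is glued at a vertex or not at all: no corner appears or disappears, so
    the old multiplicities stay and every new letter occurs once. *)
Lemma good_ext V N s w s' w' : good (V `\` N) s' w' -> core V s w ->
  square_closed V N -> {in N, forall v, ~ three_nbrs V v} ->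
  {in N, forall v, ~ corner V v} ->
  (forall u v, corner (V `\` N) u -> v \in N -> ~~ grid_adj u v) ->
  {in N, forall u, count_mem u w = 1%N} ->
  {in V `\` N, forall u, count_mem u w = count_mem u w'} ->
  (forall u, corner (V `\` N) u -> gap3 u w) ->
  good V s w.
Proof.
move=> [C' D' S'] C SC N3 NC NA cN cV G.
have cI u : corner V u -> u \in V by case=> h [_ h0 _ _] <-.
have cO u : corner V u -> u \in V `\` N.
  by move=> cu; rewrite inE (cI _ cu) andbT; apply/negP => /NC.
split=> // u.
  move=> cu; have uV := cO _ cu; have cu' := corner_shrink SC N3 uV cu.
  by rewrite cV //; case: (D' _ cu') => -> _; split=> //; apply: G.
move=> uV ncu; have [uN|uN] := boolP (u \in N); first exact: cN.
have uV' : u \in V `\` N by rewrite inE uN.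
rewrite cV //; apply: S' => // cu; apply: ncu; apply: (corner_grow cu) => v vN; exact: NA.
Qed.

Section LowHigh.

Variables (c : pred gpoint) (f : gpoint -> nat).

(* The end square is [a = g 0 0], [b = g 1 0], [x = g 1 1], [y = g 0 1], and the rest of the graph
   lies beyond [x] and [y]. The alternatives record how the word begins: after a turn about [y],
   after a straight step, and otherwise. Their membership conditions exclude the turns for which
   the word is not ready: about [y] in the first case, about [x] in the last one. *)
Definition state (V : {fset gpoint}) (g : int -> int -> gpoint) : Prop :=
  exists w t, good V [:: g 0 0, g 1 1, g 1 0 & t] w /\
  [\/ g (-1) 1 \in V /\
        exists v r, w = [:: g 1 0, v, g 0 1, g 0 0, v, g 1 1 & r],
      exists z r, w = [:: g 1 0, g 0 1, g 0 0, z, g 1 1 & r] /\ z \notin r |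
      [|| g 2 1 \in V, g 2 2 \in V, g 0 2 \notin V | g 1 2 \notin V] /\
        exists r, w = [:: g 1 0, g 0 1, g 0 0 & r]].

Section Steps.

Variables (V : {fset gpoint}) (g : int -> int -> gpoint).
Hypothesis (FE : free_edge c V g).

Let F : frame g. Proof. by case: FE. Qed.
Let aV : g 0 0 \in V. Proof. by case: FE => _ _ /and4P[]. Qed.
Let bV : g 1 0 \in V. Proof. by case: FE => _ _ /and4P[]. Qed.
Let xV : g 1 1 \in V. Proof. by case: FE => _ _ /and4P[]. Qed.
Let yV : g 0 1 \in V. Proof. by case: FE => _ _ /and4P[]. Qed.

Lemma free_nbr11 v : g 2 1 \notin V -> g 1 2 \notin V -> v \in V ->
  grid_adj (g 1 1) v -> v = g 1 0 \/ v = g 0 1.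
Proof.
move=> n1 n2 vV uv.
have [E|E|E|E] := frame_nbr F uv (i1 := 2) (i2 := 0) (j1 := 2) (j2 := 0) erefl erefl erefl erefl; auto.
  by rewrite -E vV in n1.
by rewrite -E vV in n2.
Qed.

Lemma free_nbr01 v : g (-1) 1 \notin V -> g 0 2 \notin V -> v \in V ->
  grid_adj (g 0 1) v -> v = g 0 0 \/ v = g 1 1.
Proof.
move=> n1 n2 vV uv.
have [E|E|E|E] := frame_nbr F uv (i1 := 1) (i2 := -1) (j1 := 2) (j2 := 0) erefl erefl erefl erefl; auto.
  by rewrite -E vV in n1.
by rewrite -E vV in n2.
Qed.

Lemma adj_only (N : {fset gpoint}) u p q : p \in N ->
  (forall v, v \in V -> grid_adj u v -> v = p \/ v = q) -> grid_adj u q ->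
  {in V `\` N, forall v, grid_adj u v = (v == q)}.
Proof.
move=> pN H uq v; rewrite inE => /andP[vN vV]; case: eqP => [->//|/eqP ne].
apply/negP => uv; case: (H _ vV uv) => E; first by rewrite E pN in vN.
by rewrite E eqxx in ne.
Qed.

Lemma state_disjoint (N : {fset gpoint}) s w :
  N =i [:: g 0 0; g 1 1; g 1 0; g 0 1] ->
  [&& g (-1) 1 \notin V, g 0 2 \notin V, g 1 2 \notin V & g 2 1 \notin V] ->
  good (V `\` N) s w -> state V g.
Proof.
move=> EN /and4P[m1 m2 m3 m4] G.
have clo u v : u \in N -> v \in V -> grid_adj u v -> v \in N.
  move=> uN vV uv; move: uN uv; rewrite !EN !inE => /or4P[] /eqP-> uv.
  - by case: (free_nbr00 FE vV uv) => ->; rewrite eqxx ?orbT.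
  - by case: (free_nbr11 m4 m3 vV uv) => ->; rewrite eqxx ?orbT.
  - by case: (free_nbr10 FE vV uv) => ->; rewrite eqxx ?orbT.
  - by case: (free_nbr01 m1 m2 vV uv) => ->; rewrite eqxx ?orbT.
have [k1 k2 k3 k4] := free_not_corner FE.
have Un : uniq [:: g 0 0; g 1 1; g 1 0; g 0 1] by rewrite /= !inE !(frame_inj F).
exists [:: g 1 0, g 0 1, g 0 0, g 1 1 & w], (g 0 1 :: s); split; last first.
  by constructor 3; rewrite m2 !orbT; split=> //; exists (g 1 1 :: w).
have C : core V [:: g 0 0, g 1 1, g 1 0, g 0 1 & s] [:: g 1 0, g 0 1, g 0 0, g 1 1 & w].
  apply: (core_disjoint EN) => //; rewrite ?(frame_adj F) //; first exact/and4P.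
    exact: good_core G.
  by move=> u v uN; rewrite inE => /andP[vN vV]; apply: contraNF vN; apply: clo.
have cw u : u \in N -> count_mem u w = 0%N.
  by move=> uN; apply/count_memPn; rewrite (core_w (good_core G)) inE uN.
apply: (good_ext G C).
- exact: isolated_square_closed.
- move=> v; rewrite EN !inE => /or4P[] /eqP->.
  + exact: (two_not_three (free_nbr00 FE)).
  + by apply: two_not_three => v0; apply: free_nbr11.
  + exact: (two_not_three (free_nbr10 FE)).
  + by apply: two_not_three => v0; apply: free_nbr01.
- by move=> v; rewrite EN !inE => /or4P[] /eqP->.
- move=> u v [h [_ h0 _ _] <-] vN; move: h0; rewrite inE => /andP[hN hV].
  by apply: contra hN; rewrite grid_adj_sym; apply: clo.
- move=> u uN; rewrite /= cw // addn0; move: uN; rewrite EN !inE => /or4P[] /eqP->;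
  by rewrite ?eqxx !(frame_inj F).
- move=> u; rewrite inE => /andP[]; rewrite EN !inE !negb_or => /and4P[u1 u2 u3 u4] _ /=.
  by rewrite ![_ == u]eq_sym (negPf u1) (negPf u2) (negPf u3) (negPf u4).
- by move=> u cu; do 4!apply: gap3_cons; case: (good_double G cu).
Qed.

(** The vertex [x] gains the neighbours [b] and [y]. Had it been a corner of the rest it would cease
    to be one and its second copy would be wrong, hence the condition on [g 1 1]. *)
Lemma state_vertex_low (N : {fset gpoint}) t w :
  N =i [:: g 0 0; g 1 0; g 0 1] ->
  (g (-1) 1 \notin V) && (g 0 2 \notin V) ->
  ~ corner (V `\` N) (g 1 1) ->
  good (V `\` N) (g 1 1 :: t) w -> state V g.
Proof.
move=> EN /andP[m1 m2] nc G.
have [k1 k2 k3 k4] := free_not_corner FE.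
have aN : g 0 0 \in N by rewrite EN !inE eqxx.
have bN : g 1 0 \in N by rewrite EN !inE eqxx !orbT.
have yN : g 0 1 \in N by rewrite EN !inE eqxx !orbT.
have eb := adj_only aN (free_nbr10 FE); rewrite (frame_adj F) in eb; move/(_ isT): eb => eb.
have ey := adj_only aN (fun v => free_nbr01 (v := v) m1 m2); rewrite (frame_adj F) in ey.
move/(_ isT): ey => ey.
have ea : {in V `\` N, forall v, grid_adj (g 0 0) v = false}.
  move=> v; rewrite inE => /andP[vN vV]; apply: contraNF vN => /(free_nbr00 FE vV).
  by case=> ->.
exists [:: g 1 0, g 0 1, g 0 0 & w], (g 0 1 :: t); split; last first.
  by constructor 3; rewrite m2 !orbT; split=> //; exists w.
have C : core V [:: g 0 0, g 1 1, g 1 0, g 0 1 & t] [:: g 1 0, g 0 1, g 0 0 & w].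
  apply: (core_vertex_low EN) => //; rewrite ?(frame_adj F) //; first exact/and3P.
    by rewrite /= !inE !(frame_inj F).
  exact: good_core G.
have cw u : u \in N -> count_mem u w = 0%N.
  by move=> uN; apply/count_memPn; rewrite (core_w (good_core G)) inE uN.
apply: (good_ext G C).
- apply: (pendant_square_closed EN (free_nbr00 FE) (free_nbr10 FE)).
  by move=> v; apply: free_nbr01.
- move=> v; rewrite EN !inE => /or3P[] /eqP->.
  + exact: (two_not_three (free_nbr00 FE)).
  + exact: (two_not_three (free_nbr10 FE)).
  + by apply: two_not_three => v0; apply: free_nbr01.
- by move=> v; rewrite EN !inE => /or3P[] /eqP->.
- move=> u v cu vN; have [h [_ h0 _ _] hu] := cu; rewrite hu in h0.
  rewrite grid_adj_sym; move: vN; rewrite EN !inE => /or3P[] /eqP->.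
  + by rewrite ea.
  + by rewrite eb //; apply/eqP => E; apply: nc; rewrite -E.
  + by rewrite ey //; apply/eqP => E; apply: nc; rewrite -E.
- move=> u uN; rewrite /= cw // addn0; move: uN; rewrite EN !inE => /or3P[] /eqP->;
  by rewrite ?eqxx !(frame_inj F).
- move=> u; rewrite inE => /andP[]; rewrite EN !inE !negb_or => /and3P[u1 u2 u3] _ /=.
  by rewrite ![_ == u]eq_sym (negPf u1) (negPf u2) (negPf u3).
- by move=> u cu; do 3!apply: gap3_cons; case: (good_double G cu).
Qed.

Lemma state_vertex_high (N : {fset gpoint}) s w :
  N =i [:: g 1 0; g 0 0; g 1 1] ->
  (g 2 1 \notin V) && (g 1 2 \notin V) ->
  ~ corner (V `\` N) (g 0 1) ->
  good (V `\` N) s (g 0 1 :: w) -> state V g.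
Proof.
move=> EN /andP[m1 m2] nc G.
have [k1 k2 k3 k4] := free_not_corner FE.
have aN : g 0 0 \in N by rewrite EN !inE eqxx !orbT.
have bN : g 1 0 \in N by rewrite EN !inE eqxx.
have xN : g 1 1 \in N by rewrite EN !inE eqxx !orbT.
have ea := adj_only bN (free_nbr00 FE); rewrite (frame_adj F) in ea; move/(_ isT): ea => ea.
have ex := adj_only bN (fun v => free_nbr11 (v := v) m1 m2); rewrite (frame_adj F) in ex.
move/(_ isT): ex => ex.
have eb : {in V `\` N, forall v, grid_adj (g 1 0) v = false}.
  move=> v; rewrite inE => /andP[vN vV]; apply: contraNF vN => /(free_nbr10 FE vV).
  by case=> ->.
have yV' : g 0 1 \in V `\` N by rewrite inE yV andbT EN !inE !(frame_inj F).
have yw : g 0 1 \notin w.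
  have := good_single G yV' nc; rewrite /= eqxx => -[E].
  exact/count_memPn.
exists [:: g 1 0, g 0 1, g 0 0, g 1 1 & w], s; split; last first.
  by constructor 3; rewrite m2 !orbT; split=> //; exists (g 1 1 :: w).
have C : core V [:: g 0 0, g 1 1, g 1 0 & s] [:: g 1 0, g 0 1, g 0 0, g 1 1 & w].
  apply: (core_vertex_high EN) => //; rewrite ?(frame_adj F) //; first exact/and3P.
    by rewrite /= !inE !(frame_inj F).
  exact: good_core G.
have cw u : u \in N -> count_mem u w = 0%N.
  move=> uN; apply/count_memPn; have := core_w (good_core G) u.
  by rewrite !inE uN /= => /norP[].
apply: (good_ext G C).
- have := pendant_square_closed EN (free_nbr10 FE) (free_nbr00 FE); apply.
  by move=> v; apply: free_nbr11.
- move=> v; rewrite EN !inE => /or3P[] /eqP->.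
  + exact: (two_not_three (free_nbr10 FE)).
  + exact: (two_not_three (free_nbr00 FE)).
  + by apply: two_not_three => v0; apply: free_nbr11.
- by move=> v; rewrite EN !inE => /or3P[] /eqP->.
- move=> u v cu vN; have [h [_ h0 _ _] hu] := cu; rewrite hu in h0.
  rewrite grid_adj_sym; move: vN; rewrite EN !inE => /or3P[] /eqP->.
  + by rewrite eb.
  + by rewrite ea //; apply/eqP => E; apply: nc; rewrite -E.
  + by rewrite ex //; apply/eqP => E; apply: nc; rewrite -E.
- move=> u uN; rewrite /= cw // addn0; move: uN; rewrite EN !inE => /or3P[] /eqP->;
  by rewrite ?eqxx !(frame_inj F).
- move=> u; rewrite inE => /andP[]; rewrite EN !inE !negb_or => /and3P[u1 u2 u3] _ /=.
  by rewrite ![_ == u]eq_sym (negPf u1) (negPf u2) (negPf u3) /= add0n.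
- move=> u cu; have [_] := good_double G cu; move/gap3_behead => H.
  have {H} : gap3 u w by apply: H; apply/eqP => E; apply: nc; rewrite -E.
  exact: (@gap3_cat _ u [:: _; _; _; _]).
Qed.

End Steps.

End LowHigh.

(** * Gluing along an edge: straight steps and turns *)

Section EdgeSteps.

Variables (c : pred gpoint) (V : {fset gpoint}) (g : int -> int -> gpoint).
Hypothesis (FE : free_edge c V g).
Variable (N : {fset gpoint}).
Hypothesis (EN : N =i [:: g 0 0; g 1 0]).

Let F : frame g. Proof. by case: FE. Qed.
Let aV : g 0 0 \in V. Proof. by case: FE => _ _ /and4P[]. Qed.
Let bV : g 1 0 \in V. Proof. by case: FE => _ _ /and4P[]. Qed.
Let xV : g 1 1 \in V. Proof. by case: FE => _ _ /and4P[]. Qed.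
Let yV : g 0 1 \in V. Proof. by case: FE => _ _ /and4P[]. Qed.
Let aN : g 0 0 \in N. Proof. by rewrite EN !inE eqxx. Qed.
Let bN : g 1 0 \in N. Proof. by rewrite EN !inE eqxx orbT. Qed.

Lemma keep_point i j : g i j \in V -> ~~ ((j == 0) && ((i == 0) || (i == 1))) ->
  g i j \in V `\` N.
Proof.
move=> gV; rewrite inE gV andbT EN !inE !(frame_inj F).
by case: (j == 0); rewrite ?andbF // !andbT.
Qed.

(** The only surviving neighbours of the removed points are [g 0 1] and [g 1 1], so a square that
    loses a vertex but keeps an edge is the end square, met along its far edge in one of two
    directions. *)
Lemma edge_square h : frame h -> h 0 0 \in V `\` N -> h 1 0 \in V `\` N ->
  h 0 1 \in V -> h 1 1 \in V ->
  [\/ (h 0 1 \in V `\` N) && (h 1 1 \in V `\` N),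
      [/\ h 0 0 = g 0 1, h 1 0 = g 1 1, h 0 1 = g 0 0 & h 1 1 = g 1 0] |
      [/\ h 0 0 = g 1 1, h 1 0 = g 0 1, h 0 1 = g 1 0 & h 1 1 = g 0 0]].
Proof.
move=> Fh h0 h1 h2 h3.
have inV v : v \in V `\` N -> v \in V by rewrite inE => /andP[].
have no v : v \in V `\` N -> v \in N -> False by rewrite inE => /andP[/negPf->].
have A : grid_adj (h 0 1) (h 0 0) by rewrite frame_adj.
have B : grid_adj (h 0 1) (h 1 1) by rewrite frame_adj.
have C : grid_adj (h 1 1) (h 1 0) by rewrite frame_adj.
have B' : grid_adj (h 1 1) (h 0 1) by rewrite frame_adj.
have D : h 1 1 != h 0 0 by rewrite (frame_inj Fh).
have D' : h 0 1 != h 1 0 by rewrite (frame_inj Fh).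
have ka v : v \in V `\` N -> grid_adj (g 0 0) v -> v = g 0 1.
  by move=> vV av; case: (free_nbr00 FE (inV _ vV) av) => // E; case: (no _ vV); rewrite E.
have kb v : v \in V `\` N -> grid_adj (g 1 0) v -> v = g 1 1.
  by move=> vV av; case: (free_nbr10 FE (inV _ vV) av) => // E; case: (no _ vV); rewrite E.
have [n2|] := boolP (h 0 1 \in N).
  move: n2; rewrite EN !inE => /orP[] /eqP E; rewrite E in A B.
    have E0 := ka _ h0 A; case: (free_nbr00 FE h3 B) => E3; last by rewrite E0 E3 eqxx in D.
    by constructor 2; split=> //; apply: kb => //; rewrite -E3.
  have E0 := kb _ h0 A; case: (free_nbr10 FE h3 B) => E3; last by rewrite E0 E3 eqxx in D.
  by constructor 3; split=> //; apply: ka => //; rewrite -E3.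
have [n3 n2|n3 n2] := boolP (h 1 1 \in N); last first.
  by constructor 1; rewrite !inE n2 n3 h2 h3.
move: n3; rewrite EN !inE => /orP[] /eqP E; rewrite E in C B'.
  have E0 := ka _ h1 C; case: (free_nbr00 FE h2 B') => E3; last by rewrite E0 E3 eqxx in D'.
  by rewrite E3 bN in n2.
have E0 := kb _ h1 C; case: (free_nbr10 FE h2 B') => E3; last by rewrite E0 E3 eqxx in D'.
by rewrite E3 aN in n2.
Qed.

(** The edge from [x] to [y] loses the end square, and the square with [g 0 2] and [g 1 2] takes
    over. *)
Lemma split_edge f : split_graph c f V -> g 0 2 \in V -> g 1 2 \in V ->
  split_graph c f (V `\` N).
Proof.
move=> HV v02 v12; apply: split_remove => // [h Fh h0 h1 h2 h3|u].
  case: (edge_square Fh h0 h1 h2 h3) => [-> //|[E0 E1 E2 E3]|[E0 E1 E2 E3]].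
    have -> : h 0 (-1) = g 0 2 by apply: (frame_opposite F Fh E0 E2).
    have -> : h 1 (-1) = g 1 2 by apply: (frame_opposite F Fh E1 E3).
    by rewrite !keep_point ?orbT.
  have -> : h 0 (-1) = g 1 2 by apply: (frame_opposite F Fh E0 E2).
  have -> : h 1 (-1) = g 0 2 by apply: (frame_opposite F Fh E1 E3).
  by rewrite !keep_point ?orbT.
rewrite inE => /andP[uN uV]; have [v vV uv] := sg_vtx HV uV.
have [vN|vN] := boolP (v \in N); last by exists v => //; rewrite inE vN.
move: vN uv; rewrite EN !inE grid_adj_sym => /orP[] /eqP-> uv.
  case: (free_nbr00 FE uV uv) => E; first by rewrite E bN in uN.
  by exists (g 1 1); [rewrite keep_point | rewrite E (frame_adj F)].
case: (free_nbr10 FE uV uv) => E; first by rewrite E aN in uN.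
by exists (g 0 1); [rewrite keep_point | rewrite E (frame_adj F)].
Qed.

(** An arm of the corner is lost only when it is the end square; the corner is then opposite to it
    in the next square, and its other arm shows the direction of the turn. The second arm is treated
    by swapping the axes of [h]. *)
Lemma corner_edge_half h : corner_frame V h ->
  [\/ (h 2 0 \in V `\` N) && (h 2 1 \in V `\` N),
      h 0 0 = g 0 2 /\ g 2 1 \in V | h 0 0 = g 1 2 /\ g (-1) 1 \in V].
Proof.
move=> ch; have [t1 t2 t3] := corner_frame_three ch.
case: ch => Fh h0 _ /and4P[h4 h5 h6 /and4P[h7 h8 h9 h10]].
have N3 v : v \in N -> ~ three_nbrs V v.
  rewrite EN !inE => /orP[] /eqP->.
    exact: (two_not_three (free_nbr00 FE)).
  exact: (two_not_three (free_nbr10 FE)).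
have out v : v \in V -> three_nbrs V v -> v \in V `\` N.
  by move=> vV tv; rewrite inE vV andbT; apply/negP => /N3; apply.
have Fa : frame (fun i j => h (1 + j) i) by remap Fh 1 0 0 1 1 0.
have := edge_square Fa (out _ h4 t1) (out _ h6 t3) h7 h8.
case=> [->|[E0 E1 E2 E3]|[E0 E1 E2 E3]]; first by constructor 1.
  constructor 2; split.
    exact: (frame_opposite (i := 1) (j := 0) (k := 2) (l := 0) F Fh E0 E2).
  have <- : h 1 2 = g 2 1 by exact: (frame_opposite (i := 1) (j := 1) (k := 1) (l := 0) F Fh E1 E0).
  exact: h10.
constructor 3; split.
  exact: (frame_opposite (i := 1) (j := 0) (k := 2) (l := 0) F Fh E0 E2).
have <- : h 1 2 = g (-1) 1 by exact: (frame_opposite (i := 1) (j := 1) (k := 1) (l := 0) F Fh E1 E0).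
exact: h10.
Qed.

Lemma corner_edge_shrink u : corner V u ->
  [\/ corner (V `\` N) u, u = g 0 2 /\ g 2 1 \in V | u = g 1 2 /\ g (-1) 1 \in V].
Proof.
move=> cu; have [k1 k2 k3 k4] := free_not_corner FE.
have uN : u \notin N by rewrite EN !inE; apply/negP => /orP[] /eqP E; rewrite E in cu.
case: cu uN => h ch <- uN.
have [P1|P1|P1] := corner_edge_half ch; [|by constructor 2|by constructor 3].
have [P2|P2|P2] := corner_edge_half (corner_frame_swap ch);
  [|by constructor 2|by constructor 3].
constructor 1; exists h => //.
have [t1 t2 t3] := corner_frame_three ch.
case: ch => Fh h0 /andP[n1 n2] /and4P[h4 h5 h6 /and4P[h7 h8 h9 h10]].
have N3 v : v \in N -> ~ three_nbrs V v.
  rewrite EN !inE => /orP[] /eqP->.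
    exact: (two_not_three (free_nbr00 FE)).
  exact: (two_not_three (free_nbr10 FE)).
have out v : v \in V -> three_nbrs V v -> v \in V `\` N.
  by move=> vV tv; rewrite inE vV andbT; apply/negP => /N3; apply.
split=> //.
- by rewrite inE uN.
- by rewrite !inE !negb_and n1 n2 !orbT.
- case/andP: P1 => -> ->; case/andP: P2 => -> ->.
  by rewrite (out _ h4 t1) (out _ h5 t2) (out _ h6 t3).
Qed.

Let ea : {in V `\` N, forall v, grid_adj (g 0 0) v = (v == g 0 1)}.
Proof. by apply: (adj_only bN (free_nbr00 FE)); rewrite (frame_adj F). Qed.

Let eb : {in V `\` N, forall v, grid_adj (g 1 0) v = (v == g 1 1)}.
Proof. by apply: (adj_only aN (free_nbr10 FE)); rewrite (frame_adj F). Qed.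

Lemma corner_edge_grow u : ~ corner (V `\` N) (g 1 1) -> ~ corner (V `\` N) (g 0 1) ->
  corner (V `\` N) u -> corner V u.
Proof.
move=> nx ny cu; apply: (corner_grow cu) => v.
have [h [_ h0 _ _] hu] := cu; rewrite hu in h0.
rewrite EN !inE grid_adj_sym => /orP[] /eqP->.
  by rewrite ea //; apply/eqP => E; apply: ny; rewrite -E.
by rewrite eb //; apply/eqP => E; apply: nx; rewrite -E.
Qed.

(* [D] selects the doubled letters: the old corners, and the corner created by a turn. *)
Lemma good_edge (D : gpoint -> Prop) t m w :
  core (V `\` N) (g 1 1 :: t) (m ++ g 0 1 :: w) ->
  g 0 1 \notin w -> {subset m <= w} ->
  (forall u, corner V u <-> u \in V `\` N /\ D u) ->
  (forall u, u \in V `\` N -> ~ D u -> count_mem u (m ++ g 0 1 :: w) = 1%N) ->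
  (forall u, u \in V `\` N -> D u -> count_mem u (m ++ g 0 1 :: w) = 2%N /\
     gap3 u (m ++ [:: g 0 1, g 0 0 & w])) ->
  good V [:: g 0 0, g 1 1, g 1 0 & t] (g 1 0 :: m ++ [:: g 0 1, g 0 0 & w]).
Proof.
move=> C yw mw cD c1 c2.
have cnt u : count_mem u (g 1 0 :: m ++ [:: g 0 1, g 0 0 & w]) =
    ((g 1 0 == u) + (g 0 0 == u) + count_mem u (m ++ g 0 1 :: w))%N.
  by rewrite /= !count_cat /=; clear; lia.
have old u : u \in V `\` N -> (g 1 0 == u = false) * (g 0 0 == u = false).
  by rewrite inE EN !inE negb_or => /andP[/andP[/negPf u1 /negPf u2] _]; rewrite ![_ == u]eq_sym u1 u2.
split.
- by apply: (core_edge EN) => //; rewrite ?(frame_adj F) ?(frame_inj F).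
- move=> u /cD[uV Du]; rewrite cnt !old //; have [-> G] := c2 _ uV Du.
  by split=> //; apply: gap3_cons.
- move=> u uV nc; rewrite cnt.
  have [uN|uN] := boolP (u \in N); last first.
    have uV' : u \in V `\` N by rewrite inE uN.
    by rewrite !old // c1 // => Du; apply: nc; exact/cD.
  have -> : count_mem u (m ++ g 0 1 :: w) = 0%N.
    by apply/count_memPn; rewrite (core_w C) inE uN.
  by move: uN; rewrite EN !inE => /orP[] /eqP->; rewrite ?eqxx !(frame_inj F).
Qed.

(** No corner is created, and the word becomes [b y a] followed by the old word without its leading
    [y]. The first alternative of [state] turns into the third, witnessed by [g 2 2]; the other two
    turn into the second, with [z] the point [g 1 2], which occurs once. *)
Lemma state_straight : free_edge c (V `\` N) (fun i j => g (1 - i) (1 + j)) ->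
  state (V `\` N) (fun i j => g (1 - i) (1 + j)) ->
  g 2 1 \notin V -> g (-1) 1 \notin V -> state V g.
Proof.
move=> FE' [w [t [G Sh]]] n1 n2.
have [nx ny _ nu] : [/\ ~ corner (V `\` N) (g 1 1), ~ corner (V `\` N) (g 0 1),
   ~ corner (V `\` N) (g 0 2) & ~ corner (V `\` N) (g 1 2)] := free_not_corner FE'.
have {}G : good (V `\` N) [:: g 1 1, g 0 2, g 0 1 & t] w := G.
have [xV' yV' uV'] : [/\ g 1 1 \in V `\` N, g 0 1 \in V `\` N & g 1 2 \in V `\` N].
  by case: FE' => _ _ /and4P[].
have cD u : corner V u <-> u \in V `\` N /\ corner (V `\` N) u.
  split=> [cu|[_]]; last exact: corner_edge_grow.
  suff cu' : corner (V `\` N) u by split=> //; case: cu' => h [_ h0 _ _] <-.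
  case: (corner_edge_shrink cu) => // -[_ H]; first by rewrite H in n1.
  by rewrite H in n2.
have step r : w = g 0 1 :: r ->
    good V [:: g 0 0, g 1 1, g 1 0, g 0 2, g 0 1 & t] [:: g 1 0, g 0 1, g 0 0 & r].
  move=> Ew; rewrite Ew in G.
  have yr : g 0 1 \notin r.
    by apply: (@count1_cat _ _ [:: g 0 1]); rewrite ?mem_head //; exact: (good_single G).
  apply: (@good_edge (corner (V `\` N)) _ [::]) => //; first exact: good_core G.
    by move=> u uV nc; exact: (good_single G).
  move=> u uV cu; have [-> gap] := good_double G cu; split=> //.
  apply: (@gap3_cat _ _ [:: _; _]); apply: gap3_behead gap.
  by apply/eqP => E; apply: ny; rewrite -E.
case: Sh => [[m [v [r E]]]|[z [r [E zr]]]|[_ [r E]]].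
- have {}m : g 2 2 \in V `\` N := m; have {}E : w = g 0 1 :: [:: v, g 1 2, g 1 1, v, g 0 2 & r] := E.
  do 2!eexists; split; first exact: step E.
  constructor 3; split; last by eexists.
  by move: m; rewrite inE => /andP[_ ->]; rewrite orbT.
- have {}E : w = g 0 1 :: [:: g 1 2, g 1 1, z, g 0 2 & r] := E.
  do 2!eexists; split; first exact: step E.
  constructor 2; exists (g 1 2), [:: z, g 0 2 & r]; split=> //.
  apply: (@count1_cat _ _ [:: g 0 1; g 1 2; g 1 1]); last by rewrite !inE eqxx orbT.
  by rewrite -[_ ++ _]E; exact: (good_single G).
- have {}E : w = g 0 1 :: [:: g 1 2, g 1 1 & r] := E.
  do 2!eexists; split; first exact: step E.
  constructor 2; exists (g 1 2), r; split=> //.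
  apply: (@count1_cat _ _ [:: g 0 1; g 1 2; g 1 1]); last by rewrite !inE eqxx orbT.
  by rewrite -[_ ++ _]E; exact: (good_single G).
Qed.

(** Turn about [x]: the low corner [g 0 2] is labelled just before [x]. Exchanging the two labels
    costs a second copy of the corner right after [x], and [z], [x] are the letters in between. *)
Lemma state_turn_low : free_edge c (V `\` N) (fun i j => g j (2 - i)) ->
  state (V `\` N) (fun i j => g j (2 - i)) ->
  g 2 0 \notin V -> g (-1) 1 \notin V -> g 2 1 \in V -> g 2 2 \in V -> state V g.
Proof.
move=> FE' [w [t [G Sh]]] n1 n2 v21 v22.
have [nv ny nx nu] : [/\ ~ corner (V `\` N) (g 0 2), ~ corner (V `\` N) (g 0 1),
   ~ corner (V `\` N) (g 1 1) & ~ corner (V `\` N) (g 1 2)] := free_not_corner FE'.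
have {}G : good (V `\` N) [:: g 0 2, g 1 1, g 0 1 & t] w := G.
have [vV' yV' xV' uV'] : [/\ g 0 2 \in V `\` N, g 0 1 \in V `\` N, g 1 1 \in V `\` N & g 1 2 \in V `\` N].
  by case: FE' => _ _ /and4P[].
have sub v : v \in V `\` N -> v \in V by rewrite inE => /andP[].
have cv : corner V (g 0 2).
  exists (fun i j => g j (2 - i)) => //.
  have Fk : frame (fun i j => g j (2 - i)) by remap F 0 2 0 1 (-1) 0.
  case: FE' => _ _ _ /and4P[k1 k2 _ _]; split=> //.
  - exact: sub vV'.
  - apply/andP; split.
      by apply: contra k1 => k1; apply: keep_point.
    by apply: contra k2 => k2; apply: keep_point.
  - have uV := sub _ uV'; by apply/and4P; split=> //; apply/and4P; split.
have cD u : corner V u <-> u \in V `\` N /\ (corner (V `\` N) u \/ u = g 0 2).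
  split=> [cu|[_ [|->]]] //; last exact: corner_edge_grow.
  case: (corner_edge_shrink cu) => [cu'|[-> _]|[_ H]].
  - by split; [case: cu' => h [_ h0 _ _] <- | left].
  - by split=> //; right.
  - by rewrite H in n2.
have [Un Es Ew Rw] := good_core G.
have ne p u : ~ corner (V `\` N) p -> corner (V `\` N) u -> u == p = false.
  by move=> np cu; apply/eqP => Eu; apply: np; rewrite -Eu.
(* The new copy goes in before [r] and must not widen the gap of an old corner. In the first
   alternative the gap of the corner [z] ends before [x]; in the second, [z \notin r] shows that [z]
   occurs once and is no corner. The gaps of all other corners lie inside [r]. *)
have [m [z [r [Em gm]]]] : exists m z r, w = g 0 1 :: m ++ [:: g 0 2, z, g 1 1 & r] /\
    forall u, corner (V `\` N) u -> gap3 u (m ++ [:: g 0 2, z, g 1 1, g 0 2 & r]).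
  case: Sh => [[_ [z [r E]]]|[z [r [E zr]]]|[H _]].
  - have {}E : w = [:: g 0 1; z; g 1 2; g 0 2; z; g 1 1] ++ r := E.
    exists [:: z; g 1 2], z, r; split=> // u cu.
    have [->|uz] := eqVneq u z; first by exists [::], (g 1 2), (g 0 2), [:: g 1 1, g 0 2 & r].
    have [_] := good_double G cu; rewrite E => gu.
    apply: (@gap3_cat _ _ [:: _; _; _; _; _; _]); apply: gap3_drop gu.
    by rewrite !inE (negPf uz) !ne.
  - have {}E : w = [:: g 0 1; g 1 2; g 0 2; z; g 1 1] ++ r := E.
    exists [:: g 1 2], z, r; split=> // u cu.
    have [k] := good_double G cu; rewrite E => gu.
    apply: (@gap3_cat _ _ [:: _; _; _; _; _]); apply: gap3_drop gu.
    rewrite !inE (ne _ _ ny cu) (ne _ _ nu cu) (ne _ _ nv cu) (ne _ _ nx cu) /= orbF.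
    apply/eqP => Eu; rewrite -Eu in zr; move: k; rewrite E count_cat (count_memPn zr) -Eu /=.
    have ne' p : ~ corner (V `\` N) p -> p == u = false by rewrite eq_sym => /ne; apply.
    by rewrite eqxx !ne'.
  (* Read in the frame [g j (2 - i)], the four conditions say that [g 1 0] or [g 2 0] is present, or
     that [g 2 2] or [g 2 1] is missing. All are false here. *)
  - case/or4P: H => H.
    + by have : g 1 0 \in V `\` N := H; rewrite inE bN.
    + by have : g 2 0 \in V `\` N := H; rewrite inE (negPf n1) andbF.
    + by have : g 2 2 \notin V `\` N := H; rewrite keep_point.
    + by have : g 2 1 \notin V `\` N := H; rewrite keep_point.
rewrite Em in G Ew Rw.
have cnt u : count_mem u (g 0 1 :: m ++ [:: g 0 2, z, g 1 1, g 0 2 & r]) =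
    (count_mem u (g 0 1 :: m ++ [:: g 0 2, z, g 1 1 & r]) + (g 0 2 == u))%N.
  by rewrite /= !count_cat /=; clear; lia.
have C : core (V `\` N) [:: g 1 1, g 0 2, g 0 1 & t]
    (g 0 1 :: m ++ [:: g 0 2, z, g 1 1, g 0 2 & r]).
  split.
  - by move: Un; rewrite /= !inE !negb_or [g 1 1 == g 0 2]eq_sym => /and4P[/and3P[-> -> ->] -> -> ->].
  - by move=> v; rewrite -Es !inE orbCA.
  - move=> v; rewrite -Ew !inE !mem_cat !inE.
    by case: (v == g 0 2); case: (v \in r); rewrite ?orbT ?orbF.
  - have := @rep_double_low _ grid_adj (g 0 2) (g 1 1) (g 0 1) t (g 0 1 :: m ++ [:: g 0 2; z]) r Un.
    rewrite !inE mem_cat !inE eqxx !orbT (frame_adj F) => /(_ isT isT).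
    by rewrite !cat_cons -!catA; apply.
exists [:: g 1 0, g 0 1, g 0 0 & m ++ [:: g 0 2, z, g 1 1, g 0 2 & r]], [:: g 0 2, g 0 1 & t].
split; last by constructor 3; rewrite v21; split=> //; eexists.
apply: (@good_edge (fun u => corner (V `\` N) u \/ u = g 0 2) _ [::]) => //.
- apply: (@count1_cat _ _ [:: g 0 1]); rewrite ?mem_head // cnt.
  by rewrite (good_single G yV' ny) (frame_inj F).
- move=> u uV nD; rewrite cnt (good_single G uV); last by move=> cu; apply: nD; left.
  by case: eqP => // Eu; case: nD; right.
- move=> u uV; rewrite cnt; case=> [cu|->].
    have [-> _] := good_double G cu; rewrite eq_sym ne //; split=> //.
    by apply: (@gap3_cat _ _ [:: _; _]); apply: gm.
  rewrite (good_single G vV' nv) eqxx; split=> //.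
  by exists [:: g 0 1, g 0 0 & m], z, (g 1 1), r.
Qed.

(** Turn about [y]: the high corner [g 1 2] is written just before [y]. Once doubled it can serve as
    [m], and the insertion of [a] after [y] leaves exactly [y] and [a] between its copies. *)
Lemma state_turn_high : free_edge c (V `\` N) (fun i j => g (1 - j) (1 + i)) ->
  state (V `\` N) (fun i j => g (1 - j) (1 + i)) ->
  g 2 1 \notin V -> g (-1) 1 \in V -> g (-1) 2 \in V -> state V g.
Proof.
move=> FE' [w [t [G Sh]]] n1 vm11 vm12.
have [nx nu nv ny] : [/\ ~ corner (V `\` N) (g 1 1), ~ corner (V `\` N) (g 1 2),
   ~ corner (V `\` N) (g 0 2) & ~ corner (V `\` N) (g 0 1)] := free_not_corner FE'.
have {}G : good (V `\` N) [:: g 1 1, g 0 2, g 1 2 & t] w := G.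
have [xV' uV' vV' yV'] : [/\ g 1 1 \in V `\` N, g 1 2 \in V `\` N, g 0 2 \in V `\` N & g 0 1 \in V `\` N].
  by case: FE' => _ _ /and4P[].
have sub v : v \in V `\` N -> v \in V by rewrite inE => /andP[].
have cu0 : corner V (g 1 2).
  exists (fun i j => g (1 - j) (2 - i)) => //.
  have Fk : frame (fun i j => g (1 - j) (2 - i)) by remap F 1 2 0 (-1) (-1) 0.
  case: FE' => _ _ _ /and4P[_ _ k3 k4]; split=> //.
  - exact: sub uV'.
  - apply/andP; split.
      by apply: contra k4 => k4; apply: keep_point.
    by apply: contra k3 => k3; apply: keep_point.
  - have vV := sub _ vV'; by apply/and4P; split=> //; apply/and4P; split.
have cD u : corner V u <-> u \in V `\` N /\ (corner (V `\` N) u \/ u = g 1 2).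
  split=> [cu|[_ [|->]]] //; last exact: corner_edge_grow.
  case: (corner_edge_shrink cu) => [cu'|[_ H]|[-> _]].
  - by split; [case: cu' => h [_ h0 _ _] <- | left].
  - by rewrite H in n1.
  - by split=> //; right.
have [Un Es Ew Rw] := good_core G.
have ne p u : ~ corner (V `\` N) p -> corner (V `\` N) u -> u == p = false.
  by move=> np cu; apply/eqP => Eu; apply: np; rewrite -Eu.
have [r Er] : exists r, w = [:: g 1 2, g 0 1, g 1 1 & r].
  case: Sh => [[H _]|[z [r [E _]]]|[_ [r E]]].
  (* In the turned frame the first alternative would require the removed point [a] to be present. *)
  - by have : g 0 0 \in V `\` N := H; rewrite inE aN.
  - by exists [:: z, g 0 2 & r]; exact: E.
  - by exists r; exact: E.
rewrite Er in G Ew Rw.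
have cnt u : count_mem u [:: g 1 2, g 0 1, g 1 2, g 1 1 & r] =
    (count_mem u [:: g 1 2, g 0 1, g 1 1 & r] + (g 1 2 == u))%N.
  by rewrite /=; clear; lia.
have C : core (V `\` N) [:: g 1 1, g 0 2, g 1 2 & t] [:: g 1 2, g 0 1, g 1 2, g 1 1 & r].
  split=> //.
  - by move=> v; rewrite -Ew !inE; case: (v == g 1 2); rewrite ?orbT.
  - apply: rep_double_high => //; have := Es (g 0 1).
    by rewrite yV' !inE !(frame_inj F).
exists [:: g 1 0, g 1 2, g 0 1, g 0 0, g 1 2, g 1 1 & r], [:: g 0 2, g 1 2 & t].
split; last by constructor 1; split=> //; exists (g 1 2), r.
apply: (@good_edge (fun u => corner (V `\` N) u \/ u = g 1 2) _ [:: g 1 2] [:: g 1 2, g 1 1 & r]) => //.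
- apply: (@count1_cat _ _ [:: g 1 2; g 0 1]); last by rewrite !inE eqxx orbT.
  by rewrite [LHS]cnt (good_single G yV' ny) (frame_inj F).
- by move=> u; rewrite !inE => ->.
- move=> u uV nD; rewrite [LHS]cnt (good_single G uV); last by move=> cu; apply: nD; left.
  by case: eqP => // Eu; case: nD; right.
- move=> u uV; rewrite [count_mem _ _]cnt; case=> [cu|->].
    have [-> gu] := good_double G cu; rewrite eq_sym ne //; split=> //.
    apply: (@gap3_cat _ _ [:: _; _; _; _; _]); apply: (@gap3_drop _ _ [:: g 1 2; g 0 1; g 1 1]) => //.
    by rewrite !inE !ne.
  rewrite (good_single G uV' nu) eqxx; split=> //.
  by exists [::], (g 0 1), (g 0 0), (g 1 1 :: r).
Qed.

End EdgeSteps.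

(** * Induction on the graph *)

Section Induction.

Variables (c : pred gpoint) (f : gpoint -> nat).

Local Notation "u <f v" := (leq (S (f u)) (f v)) (at level 70, only parsing).

Lemma card_remove (V N : {fset gpoint}) a : a \in V -> a \in N ->
  (#|` V `\` N| < #|` V|)%N.
Proof.
move=> aV aN; apply: fproper_ltn_card; rewrite fproperE fsubsetDl /=.
by apply/negP => /fsubsetP /(_ a aV); rewrite inE aN.
Qed.

Lemma least_high_exists V u : split_graph c f V -> u \in V -> exists b, least_high c f V b.
Proof.
move=> HV uV.
have ex : exists n, has (fun b => ~~ c b && (f b == n)) (enum_fset V).
  suff [b bV cb] : exists2 b, b \in V & ~~ c b.
    by exists (f b); apply/hasP; exists b => //; rewrite cb eqxx.
  have [v vV uv] := sg_vtx HV uV; have := sg_col HV uV vV uv.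
  by case cu: (c u) => /= cv; [exists v; rewrite ?cv|exists u; rewrite ?cu].
case: (ex_minnP ex) => m /hasP[b bV /andP[cb /eqP fb]] mm.
exists b; split=> // b' b'V cb'; rewrite fb; apply: mm.
by apply/hasP; exists b' => //; rewrite cb' eqxx.
Qed.

Lemma split_pendant (V N : {fset gpoint}) n0 n1 n2 s s' : split_graph c f V ->
  N =i [:: n0; n1; n2] ->
  (forall v, v \in V -> grid_adj n0 v -> v = n1 \/ v = n2) ->
  (forall v, v \in V -> grid_adj n1 v -> v = n0 \/ v = s) ->
  (forall v, v \in V -> grid_adj n2 v -> v = n0 \/ v = s) ->
  s' \in V `\` N -> grid_adj s s' -> split_graph c f (V `\` N).
Proof.
move=> HV EN N0 N1 N2 s'V ss'.
have i0 : n0 \in N by rewrite EN !inE eqxx.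
have i1 : n1 \in N by rewrite EN !inE eqxx !orbT.
have i2 : n2 \in N by rewrite EN !inE eqxx !orbT.
apply: split_remove => // [h Fh h0 h1 h2 h3|u].
  by rewrite (pendant_square_closed EN N0 N1 N2).
rewrite inE => /andP[uN uV]; have [v vV uv] := sg_vtx HV uV.
have [vN|vN] := boolP (v \in N); last by exists v => //; rewrite inE vN.
move: vN uv; rewrite EN !inE grid_adj_sym => /or3P[] /eqP-> uv.
- by case: (N0 _ uV uv) => E; rewrite E ?i1 ?i2 in uN.
- by case: (N1 _ uV uv) => E; [rewrite E i0 in uN | exists s' => //; rewrite E].
- by case: (N2 _ uV uv) => E; [rewrite E i0 in uN | exists s' => //; rewrite E].
Qed.

Lemma split_isolated (V N : {fset gpoint}) : split_graph c f V ->
  (forall u v, u \in N -> v \in V -> grid_adj u v -> v \in N) ->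
  split_graph c f (V `\` N).
Proof.
move=> HV H; apply: split_remove => // [h Fh h0 h1 h2 h3|u].
  by rewrite (isolated_square_closed H).
rewrite inE => /andP[uN uV]; have [v vV uv] := sg_vtx HV uV.
exists v => //; rewrite inE vV andbT; apply: contra uN => vN.
by apply: (H v) => //; rewrite grid_adj_sym.
Qed.

Section Step.

Variables (V : {fset gpoint}) (g : int -> int -> gpoint) (b : gpoint).
Hypotheses (HV : split_graph c f V) (FE : free_edge c V g) (Lb : least_high c f V b)
  (Eb : b = g 1 0 \/ b = g 0 1).
Hypothesis IH : forall N, g 0 0 \in N -> split_graph c f (V `\` N) ->
  (exists s w, good (V `\` N) s w) /\
  forall k b', free_edge c (V `\` N) k -> least_high c f (V `\` N) b' ->
    b' = k 1 0 \/ b' = k 0 1 -> state (V `\` N) k.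

Let F : frame g. Proof. by case: FE. Qed.
Let aV : g 0 0 \in V. Proof. by case: FE => _ _ /and4P[]. Qed.
Let bV : g 1 0 \in V. Proof. by case: FE => _ _ /and4P[]. Qed.
Let xV : g 1 1 \in V. Proof. by case: FE => _ _ /and4P[]. Qed.
Let yV : g 0 1 \in V. Proof. by case: FE => _ _ /and4P[]. Qed.
Let n20 : g 2 0 \notin V. Proof. by case: FE => _ _ _ /and4P[]. Qed.
Let nm10 : g (-1) 0 \notin V. Proof. by case: FE => _ _ _ /and4P[]. Qed.

Let col i j k l : coord_adj (i, j) (k, l) -> g i j \in V -> g k l \in V ->
  c (g k l) = ~~ c (g i j).
Proof. by move=> A h1 h2; apply: (sg_col HV) => //; rewrite (frame_adj F). Qed.

Let ca : c (g 0 0). Proof. by case: FE. Qed.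
Let cb : ~~ c (g 1 0). Proof. by rewrite (@col 0 0 1 0) // negbK. Qed.
Let cy : ~~ c (g 0 1). Proof. by rewrite (@col 0 0 0 1) // negbK. Qed.
Let cx : c (g 1 1). Proof. by rewrite (@col 1 0 1 1). Qed.

(* A high vertex of a subgraph avoiding [b] lies above [x], so the least one is a neighbour
   of [x] by [below_least_adj]. *)
Lemma next_least_adj N b' : split_graph c f (V `\` N) -> least_high c f (V `\` N) b' ->
  g 1 1 \in V `\` N -> grid_adj (g 1 1) b'.
Proof.
move=> HN Lb' xN; apply: (below_least_adj HN Lb' xN cx).
have [b'N cb' _] := Lb'; have [bV0 cb0 mb] := Lb.
have xb : grid_adj b (g 1 1) by case: Eb => ->; rewrite (frame_adj F).
have [_ lx] := low_nbr_least HV Lb xV xb.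
apply: leq_trans lx _; apply: mb => //; by move: b'N; rewrite inE => /andP[].
Qed.

Lemma low_below_next N b' : least_high c f (V `\` N) b' -> b = g 1 0 -> g 0 0 <f b'.
Proof.
move=> [b'N cb' _] E; have [bV0 cb0 mb] := Lb.
apply: leq_trans (_ : f b <= _)%N; last by apply: mb => //; move: b'N; rewrite inE => /andP[].
by apply: (sg_ord HV) => //; rewrite E (frame_adj F).
Qed.

Lemma least_not01 : g 0 2 \in V -> b = g 1 0.
Proof.
move=> v02; case: Eb => // E; exfalso.
have Fh : frame (fun i j => g j (1 + i)) by remap F 0 1 0 1 1 0.
exact: (least_no_opposite HV Lb Fh (esym E) v02 aV).
Qed.

Lemma square_x_right : g 2 1 \in V -> (g 1 2 \in V) && (g 2 2 \in V).
Proof.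
move=> v21; have Fh : frame (fun i j => g (1 + i) (1 + j)) by remap F 1 1 1 0 0 1.
have := sg_edge HV Fh xV v21 => /orP[//|/andP[_ h]].
by have : g 2 0 \in V := h; rewrite (negPf n20).
Qed.

Lemma square_y_left : g (-1) 1 \in V -> (g 0 2 \in V) && (g (-1) 2 \in V).
Proof.
move=> v; have Fh : frame (fun i j => g (- i) (1 + j)) by remap F 0 1 (-1) 0 0 1.
have := sg_edge HV Fh yV v => /orP[//|/andP[_ h]].
by have : g (-1) 0 \in V := h; rewrite (negPf nm10).
Qed.

Lemma square_x_up : g 1 2 \in V -> g 0 2 \notin V -> (g 2 1 \in V) && (g 2 2 \in V).
Proof.
move=> v n; have Fh : frame (fun i j => g (1 + j) (1 + i)) by remap F 1 1 0 1 1 0.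
have := sg_edge HV Fh xV v => /orP[//|/andP[_ h]].
by have : g 0 2 \in V := h; rewrite (negPf n).
Qed.

Lemma square_y_up : g 0 2 \in V -> g 1 2 \notin V -> (g (-1) 1 \in V) && (g (-1) 2 \in V).
Proof.
move=> v n; have Fh : frame (fun i j => g (- j) (1 + i)) by remap F 0 1 0 (-1) 1 0.
have := sg_edge HV Fh yV v => /orP[//|/andP[_ h]].
by have : g 1 2 \in V := h; rewrite (negPf n).
Qed.

(** The points beside the end square decide: [g 2 1] forces [b' = g 0 1] and a turn about [x],
    [g (-1) 1] forces [b' = g 1 2] and a turn about [y], and without both the chain goes
    straight. *)
Lemma state_step_edge : g 0 2 \in V -> g 1 2 \in V -> state V g.
Proof.
move=> v02 v12; have Eb1 := least_not01 v02.
pose N := [fset g 0 0; g 1 0].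
have EN : N =i [:: g 0 0; g 1 0] by move=> u; rewrite !inE.
have aN : g 0 0 \in N by rewrite EN !inE eqxx.
have bN : g 1 0 \in N by rewrite EN !inE eqxx !orbT.
have HN := split_edge FE EN HV v02 v12.
have kp := keep_point FE EN; have nk u : u \notin V -> u \notin V `\` N.
  by rewrite inE => /negPf->; rewrite andbF.
have nN u : u \in N -> u \notin V `\` N by rewrite inE => ->.
have xN : g 1 1 \in V `\` N by apply: kp.
have yN : g 0 1 \in V `\` N by apply: kp.
have uN : g 1 2 \in V `\` N by apply: kp.
have vN : g 0 2 \in V `\` N by apply: kp.
have [b' Lb'] := least_high_exists HN xN.
have xb' := next_least_adj HN Lb' xN.
have b'N : b' \in V `\` N by case: Lb'.
have Nb' : [\/ b' = g 2 1, b' = g 0 1 | b' = g 1 2].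
  have [E|E|E|E] := frame_nbr F xb' (i1 := 2) (i2 := 0) (j1 := 2) (j2 := 0) erefl erefl erefl erefl.
  - by constructor 1.
  - by constructor 2.
  - by constructor 3.
  - by move: (nN _ bN); rewrite -E b'N.
have F11 : frame (fun i j => g i (1 + j)) by remap F 0 1 1 0 0 1.
have F12 : frame (fun i j => g (1 + i) (2 + j)) by remap F 1 2 1 0 0 1.
have [v21|n21] := boolP (g 2 1 \in V).
  have /andP[_ v22] := square_x_right v21.
  have E' : b' = g 0 1.
    case: Nb' => // E'; exfalso; last first.
      apply: (least_no_opposite HN Lb' F12 (esym E')); exact: kp.
    (* If [b'] were [g 2 1], the edges from [g 0 0] to [g 0 1] and from [g 2 2] to [g 2 1] would
       induce a matching with overlapping label intervals. *)
    have c21 : ~~ c (g 2 1) by rewrite (@col 1 1 2 1) // negbK.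
    have c22 : c (g 2 2) by rewrite (@col 2 1 2 2).
    have A1 : grid_adj (g 0 0) (g 0 1) by rewrite (frame_adj F).
    have A2 : grid_adj (g 2 2) (g 2 1) by rewrite (frame_adj F).
    have := sg_ind HV _ ca c22 A1 A2; rewrite !(frame_adj F) => X.
    suff: coord_adj (0, 0) (2, 1) || coord_adj (2, 2) (0, 1) by [].
    apply: X; first exact/and4P.
      by rewrite -E'; apply: low_below_next Lb' Eb1.
    apply: leq_trans (_ : f (g 2 1) <= _)%N; first exact: (sg_ord HV).
    by rewrite -E'; case: Lb' => _ _; apply.
  have nm11 : g (-1) 1 \notin V.
    apply/negP => h; apply: (least_no_opposite HN Lb' F11 (esym E') xN); exact: kp.
  (* Since [x] has the extra neighbour [g 2 1], the other neighbour [g 0 2] of [b'] has none; so the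
     future corner is the low end of a free edge. *)
  have two q : q \in V `\` N -> grid_adj (g 0 2) q -> q != g 0 1 -> q != g 1 2 -> False.
    move=> qV aq q1 q2; rewrite -E' in q1.
    have v21N : g 2 1 \in V `\` N by apply: kp.
    apply: (@least_two_extra c f _ b' HN Lb' _ (g 2 1) q F11 (esym E') xN vN v21N _ _ _ qV aq q1 q2).
    - by rewrite (frame_adj F).
    - by rewrite E' (frame_inj F).
    - by rewrite (frame_inj F).
  have Fk : frame (fun i j => g j (2 - i)) by remap F 0 2 0 1 (-1) 0.
  have FEk : free_edge c (V `\` N) (fun i j => g j (2 - i)).
    split=> //; first by have : c (g 0 2) by rewrite (@col 0 1 0 2).
      exact/and4P.
    apply/and4P; split.
    - apply/negP => h; apply: (two (g 0 3)) => //; by rewrite ?(frame_adj F) ?(frame_inj F).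
    - apply/negP => h; apply: (two (g (-1) 2)) => //; by rewrite ?(frame_adj F) ?(frame_inj F).
    - exact: nk nm11.
    - exact: nN aN.
  apply: (state_turn_low FE EN FEk) => //.
  by apply: (proj2 (IH aN HN) _ b') => //; left.
have [vm11|nm11] := boolP (g (-1) 1 \in V).
  have /andP[_ vm12] := square_y_left vm11.
  have E' : b' = g 1 2.
    case: Nb' => // E'; exfalso.
      by move: b'N; rewrite E' (negPf (nk _ n21)).
    apply: (least_no_opposite HN Lb' F11 (esym E') xN); exact: kp.
  have Fk : frame (fun i j => g (1 - j) (1 + i)) by remap F 1 1 0 (-1) 1 0.
  have FEk : free_edge c (V `\` N) (fun i j => g (1 - j) (1 + i)).
    split=> //; first exact/and4P.
    apply/and4P; split.
    - exact: nN bN.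
    - exact: nk n21.
    - apply/negP => h; exact: (least_no_opposite HN Lb' F12 (esym E') h vN).
    - have F12' : frame (fun i j => g (1 + j) (2 + i)) by remap F 1 2 0 1 1 0.
      apply/negP => h; exact: (least_no_opposite HN Lb' F12' (esym E') h xN).
  apply: (state_turn_high FE EN FEk) => //.
  by apply: (proj2 (IH aN HN) _ b') => //; left.
have Fk : frame (fun i j => g (1 - i) (1 + j)) by remap F 1 1 (-1) 0 0 1.
have FEk : free_edge c (V `\` N) (fun i j => g (1 - i) (1 + j)).
  split=> //; first exact/and4P.
  by apply/and4P; split; [exact: nk n21|exact: nN bN|exact: nN aN|exact: nk nm11].
apply: (state_straight FE EN FEk) => //.
apply: (proj2 (IH aN HN) _ b') => //.
case: Nb' => E'; [|by left|by right].
by move: b'N; rewrite E' (negPf (nk _ n21)).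
Qed.

(** The next square lies diagonally beyond [x]. Its [b'] is adjacent to [x] and has no opposite
    neighbours, so the edge from [x] to [b'] is free and [x] comes first in the inherited
    labelling. *)
Lemma state_step_low : g 1 2 \in V -> g 0 2 \notin V -> state V g.
Proof.
move=> v12 n02; have /andP[v21 v22] := square_x_up v12 n02.
have nm11 : g (-1) 1 \notin V by apply: contra n02 => /square_y_left/andP[].
pose N := [fset g 0 0; g 1 0; g 0 1].
have EN : N =i [:: g 0 0; g 1 0; g 0 1] by move=> u; rewrite !inE orbA.
have aN : g 0 0 \in N by rewrite EN !inE eqxx.
have bN : g 1 0 \in N by rewrite EN !inE eqxx !orbT.
have yN : g 0 1 \in N by rewrite EN !inE eqxx !orbT.
have kp i j : g i j \in V -> ~~ [|| (i == 0) && (j == 0), (i == 1) && (j == 0) | (i == 0) && (j == 1)] ->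
    g i j \in V `\` N by move=> h1 h2; rewrite inE h1 andbT EN !inE !(frame_inj F).
have nk u : u \notin V -> u \notin V `\` N.
  by rewrite inE => /negPf->; rewrite andbF.
have nN u : u \in N -> u \notin V `\` N by rewrite inE => ->.
have xN : g 1 1 \in V `\` N by apply: kp.
have N12 : g 1 2 \in V `\` N by apply: kp.
have N21 : g 2 1 \in V `\` N by apply: kp.
have N22 : g 2 2 \in V `\` N by apply: kp.
have HN : split_graph c f (V `\` N).
  apply: (split_pendant HV EN (free_nbr00 FE) (free_nbr10 FE) _ N12).
    by move=> v; apply: (free_nbr01 FE).
  by rewrite (frame_adj F).
have [b' Lb'] := least_high_exists HN xN.
have xb' := next_least_adj HN Lb' xN.
have b'N : b' \in V `\` N by case: Lb'.
suff [k [FEk k0 kb]] : exists k, [/\ free_edge c (V `\` N) k, k 0 0 = g 1 1 & b' = k 1 0].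
  have [_ /(_ k b' FEk Lb' (or_introl kb)) [w [t [G _]]]] := IH aN HN.
  have [nc _ _ _] := free_not_corner FEk; rewrite k0 in nc G.
  by apply: (state_vertex_low FE EN _ nc G); rewrite nm11.
have [E|E|E|E] := frame_nbr F xb' (i1 := 2) (i2 := 0) (j1 := 2) (j2 := 0) erefl erefl erefl erefl.
- have Fk : frame (fun i j => g (1 + i) (1 + j)) by remap F 1 1 1 0 0 1.
  exists (fun i j => g (1 + i) (1 + j)); split=> //; split=> //; first exact/and4P.
  apply/and4P; split; [exact: nN yN|exact: nN bN|exact: nk n20|apply/negP => h].
  have Fh : frame (fun i j => g (2 + i) (1 + j)) by remap F 2 1 1 0 0 1.
  exact: (least_no_opposite HN Lb' Fh (esym E) h xN).
- by move: (nN _ yN); rewrite -E b'N.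
- have Fk : frame (fun i j => g (1 + j) (1 + i)) by remap F 1 1 0 1 1 0.
  exists (fun i j => g (1 + j) (1 + i)); split=> //; split=> //; first exact/and4P.
  apply/and4P; split; [exact: nN bN|exact: nN yN|exact: nk n02|apply/negP => h].
  have Fh : frame (fun i j => g (1 + j) (2 + i)) by remap F 1 2 0 1 1 0.
  exact: (least_no_opposite HN Lb' Fh (esym E) h xN).
- by move: (nN _ bN); rewrite -E b'N.
Qed.

(** The next square lies diagonally beyond [y]. The inherited word has to start with [y], so the
    free edge is chosen at [y], while [b'] may be the opposite vertex [g (-1) 2]; hence [state] is
    available for the least high vertex at either [k 1 0] or [k 0 1]. *)
Lemma state_step_high : g 0 2 \in V -> g 1 2 \notin V -> state V g.
Proof.
move=> v02 n12; have /andP[vm11 vm12] := square_y_up v02 n12.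
have Eb1 := least_not01 v02.
have n21 : g 2 1 \notin V by apply: contra n12 => /square_x_right/andP[].
pose N := [fset g 1 0; g 0 0; g 1 1].
have EN : N =i [:: g 1 0; g 0 0; g 1 1] by move=> u; rewrite !inE orbA.
have aN : g 0 0 \in N by rewrite EN !inE eqxx ?orbT.
have bN : g 1 0 \in N by rewrite EN !inE eqxx ?orbT.
have xN : g 1 1 \in N by rewrite EN !inE eqxx ?orbT.
have kp i j : g i j \in V -> ~~ [|| (i == 1) && (j == 0), (i == 0) && (j == 0) | (i == 1) && (j == 1)] ->
    g i j \in V `\` N by move=> h1 h2; rewrite inE h1 andbT EN !inE !(frame_inj F).
have nk u : u \notin V -> u \notin V `\` N.
  by rewrite inE => /negPf->; rewrite andbF.
have sub u : u \in V `\` N -> u \in V by rewrite inE => /andP[].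
have nN u : u \in N -> u \notin V `\` N by rewrite inE => ->.
have yN : g 0 1 \in V `\` N by apply: kp.
have N02 : g 0 2 \in V `\` N by apply: kp.
have Nm11 : g (-1) 1 \in V `\` N by apply: kp.
have Nm12 : g (-1) 2 \in V `\` N by apply: kp.
have HN : split_graph c f (V `\` N).
  apply: (split_pendant HV EN (free_nbr10 FE) (free_nbr00 FE) _ N02).
    by move=> v vV /(free_nbr11 FE n21 n12 vV).
  by rewrite (frame_adj F).
have [b' Lb'] := least_high_exists HN yN.
have [b'N cb' mb'] := Lb'.
have Nb' : b' = g 0 1 \/ b' = g (-1) 2.
  have [->|ny] := eqVneq b' (g 0 1); [by left|right].
  (* The edges from [g 0 0] to [g 0 1] and from [a'] to [b'] have overlapping label intervals, which
     makes [a'] adjacent to [g 0 1]. As [b'] has two neighbours, both [g 0 2] and [g (-1) 1] are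
     adjacent to it. *)
  have nb a' : a' \in V `\` N -> grid_adj b' a' -> a' = g 0 2 \/ a' = g (-1) 1.
    move=> a'N ba'; have [ca' la'] := low_nbr_least HN Lb' a'N ba'.
    have A1 : grid_adj (g 0 0) (g 0 1) by rewrite (frame_adj F).
    have A2 : grid_adj a' b' by rewrite grid_adj_sym.
    have inV : [&& g 0 0 \in V, g 0 1 \in V, a' \in V & b' \in V] by rewrite aV yV !sub.
    have := sg_ind HV inV ca ca' A1 A2 (low_below_next Lb' Eb1).
    have ly : a' <f g 0 1 by apply: leq_trans la' _; apply: mb'.
    case/(_ ly)/orP=> [/(free_nbr00 FE (sub _ b'N))[E|E]|].
    - by move: (nN _ bN); rewrite -E b'N.
    - by rewrite E eqxx in ny.
    rewrite grid_adj_sym => ya'.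
    have [E|E|E|E] := frame_nbr F ya' (i1 := 1) (i2 := -1) (j1 := 2) (j2 := 0) erefl erefl erefl erefl; auto.
      by move: (nN _ xN); rewrite -E a'N.
    by move: (nN _ aN); rewrite -E a'N.
  have [h [Fh h0 /and3P[h1 h2 _]]] := low_square_at HN b'N.
  have A1 : grid_adj b' (h 1 0) by rewrite -h0 (frame_adj Fh).
  have A2 : grid_adj b' (h 0 1) by rewrite -h0 (frame_adj Fh).
  have D : h 1 0 != h 0 1 by rewrite (frame_inj Fh).
  have [B1 B2] : grid_adj (g 0 2) b' /\ grid_adj (g (-1) 1) b'.
    rewrite ![grid_adj _ b']grid_adj_sym.
    case: (nb _ h1 A1) => E1; case: (nb _ h2 A2) => E2; rewrite E1 E2 ?eqxx // in D A1 A2.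
  have [E|E|E|E] := frame_nbr F B1 (i1 := 1) (i2 := -1) (j1 := 3) (j2 := 1) erefl erefl erefl erefl => //.
  - by move: b'N; rewrite E (negPf (nk _ n12)).
  - by move: B2; rewrite E (frame_adj F).
  - by rewrite E eqxx in ny.
(* Both low vertices of the next square are neighbours of [b'], so at most one has an extra
   neighbour; the other one forms a free edge with [y]. *)
have two : g 0 3 \in V -> g (-2) 1 \in V -> False.
  move=> v03 vm21; have N03 : g 0 3 \in V `\` N by apply: kp.
  have Nm21 : g (-2) 1 \in V `\` N by apply: kp.
  have A1 : grid_adj (g 0 2) (g 0 3) by rewrite (frame_adj F).
  have A2 : grid_adj (g (-1) 1) (g (-2) 1) by rewrite (frame_adj F).
  case: Nb' => E.
    have Fh : frame (fun i j => g (- j) (1 + i)) by remap F 0 1 0 (-1) 1 0.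
    by apply: (@least_two_extra c f _ b' HN Lb' _ _ _ Fh (esym E) N02 Nm11 N03 A1 _ _ Nm21 A2);
      rewrite ?E (frame_inj F).
  have Fh : frame (fun i j => g (i - 1) (2 - j)) by remap F (-1) 2 1 0 0 (-1).
  by apply: (@least_two_extra c f _ b' HN Lb' _ _ _ Fh (esym E) N02 Nm11 N03 A1 _ _ Nm21 A2);
      rewrite ?E (frame_inj F).
suff [k [FEk k1 kb]] : exists k, [/\ free_edge c (V `\` N) k, k 1 0 = g 0 1 & b' = k 1 0 \/ b' = k 0 1].
  have [_ /(_ k b' FEk Lb' kb) [w [t [G Sh]]]] := IH aN HN.
  have [_ nc _ _] := free_not_corner FEk; rewrite k1 in nc.
  have [r Er] : exists r, w = g 0 1 :: r.
    by rewrite -k1; case: Sh => [[_ [v [r ->]]]|[z [r [-> _]]]|[_ [r ->]]]; eexists.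
  rewrite Er in G.
  by apply: (state_vertex_high FE EN _ nc G); rewrite n21.
have [v03|n03] := boolP (g 0 3 \in V).
  have nm21 : g (-2) 1 \notin V by apply/negP; apply: two.
  have Fk : frame (fun i j => g (i - 1) (1 + j)) by remap F (-1) 1 1 0 0 1.
  exists (fun i j => g (i - 1) (1 + j)); split=> //; split=> //.
  - by have : c (g (-1) 1) by rewrite (@col 0 1 (-1) 1).
  - exact/and4P.
  - by apply/and4P; split; [exact: nk nm21|exact: nk nm10|exact: nN aN|exact: nN xN].
have Fk : frame (fun i j => g (- j) (2 - i)) by remap F 0 2 0 (-1) (-1) 0.
exists (fun i j => g (- j) (2 - i)); split=> //; split=> //.
- by have : c (g 0 2) by rewrite (@col 0 1 0 2).
- exact/and4P.
- by apply/and4P; split; [exact: nk n03|exact: nk n12|exact: nN xN|exact: nN aN].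
Qed.

Lemma state_step_disjoint : g 0 2 \notin V -> g 1 2 \notin V -> state V g.
Proof.
move=> n02 n12.
have n21 : g 2 1 \notin V by apply: contra n12 => /square_x_right/andP[].
have nm11 : g (-1) 1 \notin V by apply: contra n02 => /square_y_left/andP[].
pose N := [fset g 0 0; g 1 1; g 1 0; g 0 1].
have EN : N =i [:: g 0 0; g 1 1; g 1 0; g 0 1] by move=> u; rewrite !inE !orbA.
have aN : g 0 0 \in N by rewrite EN !inE eqxx ?orbT.
have HN : split_graph c f (V `\` N).
  apply: split_isolated => // u v uN vV uv; move: uN uv; rewrite !EN !inE => /or4P[] /eqP-> uv.
  - by case: (free_nbr00 FE vV uv) => ->; rewrite eqxx ?orbT.
  - by case: (free_nbr11 FE n21 n12 vV uv) => ->; rewrite eqxx ?orbT.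
  - by case: (free_nbr10 FE vV uv) => ->; rewrite eqxx ?orbT.
  - by case: (free_nbr01 FE nm11 n02 vV uv) => ->; rewrite eqxx ?orbT.
have [[s [w G]] _] := IH aN HN.
by apply: (state_disjoint FE EN _ G); rewrite nm11 n02 n12.
Qed.

Lemma state_step : state V g.
Proof.
have [v02|n02] := boolP (g 0 2 \in V); have [v12|n12] := boolP (g 1 2 \in V).
- exact: state_step_edge.
- exact: state_step_high.
- exact: state_step_low.
- exact: state_step_disjoint.
Qed.

End Step.

(** Induction on the number of vertices. The claim is strengthened to [state] for every free edge
    whose square has the least high vertex among its two high ones, because the next gluing
    prescribes the frame in which the inherited word is read. *)
Theorem split_graph_good V : split_graph c f V -> exists s w, good V s w.
Proof.
suff main n : forall V, (#|` V| < n)%N -> split_graph c f V ->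
  (exists s w, good V s w) /\
  forall g b, free_edge c V g -> least_high c f V b -> b = g 1 0 \/ b = g 0 1 -> state V g.
  by move=> HV; case: (main _ V (ltnSn _) HV).
elim: n => // n IHn {}V Vn HV.
have P2 g b : free_edge c V g -> least_high c f V b -> b = g 1 0 \/ b = g 0 1 -> state V g.
  move=> FE Lb Eb; apply: (state_step HV FE Lb Eb) => N aN HN.
  apply: IHn => //; have aV : g 0 0 \in V by case: FE => _ _ /and4P[].
  exact: leq_trans (card_remove aV aN) _.
split=> //; have [V0|[u uV]] := fset_0Vmem V; last first.
  have [b Lb] := least_high_exists HV uV.
  have [g [FE gb]] := least_free_edge HV Lb.
  by have [w [t [G _]]] := P2 g b FE Lb (or_introl (esym gb)); exists [:: g 0 0, g 1 1, g 1 0 & t], w.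
exists [::], [::]; split; first by split=> // v; rewrite V0.
  by move=> v [h [_ h0 _ _] _]; rewrite V0 in h0.
by move=> v; rewrite V0.
Qed.

End Induction.

(** * Squares, labels and words *)

Lemma square_nodesE u z : (u \in square_nodes z) =
  ((u.1 == z.1) || (u.1 == z.1 + 1)) && ((u.2 == z.2) || (u.2 == z.2 + 1)).
Proof.
case: u z => [u1 u2] [z1 z2]; rewrite !inE !xpair_eqE /=.
by case: (u1 == z1); case: (u1 == z1 + 1); case: (u2 == z2); case: (u2 == z2 + 1).
Qed.

Lemma square_mem V z u : is_square V z -> u \in square_nodes z -> u \in V.
Proof. by move=> /fsubsetP; apply. Qed.

Lemma square_at_edge g z : frame g -> g 0 0 \in square_nodes z -> g 1 0 \in square_nodes z ->
  (g 0 1 \in square_nodes z) && (g 1 1 \in square_nodes z) ||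
  (g 0 (-1) \in square_nodes z) && (g 1 (-1) \in square_nodes z).
Proof.
move=> [o1 [o2 [p [q [r [s [C E]]]]]]]; rewrite !E !square_nodesE /=.
move: C => [[[] -> [[] -> [-> ->]]]|[[] -> [[] -> [-> ->]]]]; clear; lia.
Qed.

Lemma square_at_vertex g z : frame g -> g 0 0 \in square_nodes z ->
  ((g 1 0 \in square_nodes z) || (g (-1) 0 \in square_nodes z)) &&
  ((g 0 1 \in square_nodes z) || (g 0 (-1) \in square_nodes z)).
Proof.
move=> [o1 [o2 [p [q [r [s [C E]]]]]]]; rewrite !E !square_nodesE /=.
move: C => [[[] -> [[] -> [-> ->]]]|[[] -> [[] -> [-> ->]]]]; clear; lia.
Qed.

Lemma square_diagonal_eq g z z' : frame g ->
  g 1 0 \in square_nodes z -> g 0 1 \in square_nodes z ->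
  g 1 0 \in square_nodes z' -> g 0 1 \in square_nodes z' -> z' = z.
Proof.
move=> [o1 [o2 [p [q [r [s [C E]]]]]]]; rewrite !E !square_nodesE /=.
case: z z' => [z1 z2] [y1 y2] /=.
move: C => [[[] -> [[] -> [-> ->]]]|[[] -> [[] -> [-> ->]]]] h1 h2 h3 h4;
  congr (_, _); move: h1 h2 h3 h4; clear; lia.
Qed.

Lemma frame_square g : frame g ->
  exists z, square_nodes z =i [:: g 0 0; g 1 0; g 0 1; g 1 1].
Proof.
move=> [o1 [o2 [p [q [r [s [C E]]]]]]].
(* One of [p], [q] is zero and the other is a sign, likewise for [r], [s]; the lower left corner is
   shifted along an axis exactly when the frame reverses that axis. *)
exists (o1 + (if p + q == 1 then 0 else -1), o2 + (if r + s == 1 then 0 else -1)).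
move=> [u1 u2]; rewrite square_nodesE !E !inE !xpair_eqE /=.
move: C => [[[] -> [[] -> [-> ->]]]|[[] -> [[] -> [-> ->]]]] /=; clear; lia.
Qed.

Lemma share_edge_adj z z' : share_edge z z' -> z' <> z ->
  (z'.1 = z.1 /\ (z'.2 = z.2 + 1 \/ z'.2 = z.2 - 1)) \/
  (z'.2 = z.2 /\ (z'.1 = z.1 + 1 \/ z'.1 = z.1 - 1)).
Proof.
move=> [[a1 a2] [[b1 b2] [[h1 h2 /grid_adjP h3] [h4 h5 _]]]] ne.
have {}ne : ~ (z'.1 = z.1 /\ z'.2 = z.2).
  by move=> [e1 e2]; apply: ne; case: z z' e1 e2 {h1 h2 h4 h5} => [? ?] [? ?] /= -> ->.
by move: h1 h2 h3 h4 h5 ne; rewrite !square_nodesE /=; clear; lia.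
Qed.

(** The two squares sharing an edge with the only square of [v] avoid [v], so they are its
    neighbours on the two sides away from [v]. *)
Lemma corner_node_corner V v : square_grid_graph V -> corner_node V v <-> corner V v.
Proof.
move=> [_ _ HE]; split.
  move=> [vV [z [[sz vz] uz _ [z1 [z2 [[s1 s2] [n1 n2 n12] e1 e2]]]]]].
  have out1 : v \notin square_nodes z1 by apply/negP => /(uz _ s1).
  have out2 : v \notin square_nodes z2 by apply/negP => /(uz _ s2).
  have a1 := share_edge_adj e1 n1; have a2 := share_edge_adj e2 n2.
  have {}n12 : ~ (z1.1 = z2.1 /\ z1.2 = z2.2).
    by move=> [E1 E2]; apply: n12; case: z1 z2 E1 E2 {a1 a2 e1 e2 s1 s2 n1 n2 out1 out2} => [? ?] [? ?] /= -> ->.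
  (* The signs point from [v] into its square, so that [g] puts [v] at the origin and the square in
     the positive quadrant. *)
  pose s : int := if v.1 == z.1 then 1 else -1; pose t : int := if v.2 == z.2 then 1 else -1.
  pose g i j : gpoint := (v.1 + s * i + 0 * j, v.2 + 0 * i + t * j).
  have s1E : s = 1 \/ s = -1 by rewrite /s; case: eqP; auto.
  have t1E : t = 1 \/ t = -1 by rewrite /t; case: eqP; auto.
  have F : frame g by exists v.1, v.2, s, 0, 0, t; split=> //; left.
  have g0 : g 0 0 = v by rewrite /g !mulr0 !addr0; case: (v).
  have sv : (s = 1 /\ v.1 = z.1) \/ (s = -1 /\ v.1 <> z.1) by rewrite /s; case: eqP; auto.
  have tv : (t = 1 /\ v.2 = z.2) \/ (t = -1 /\ v.2 <> z.2) by rewrite /t; case: eqP; auto.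
  clearbody s t.
  have nv u : grid_adj v u -> u \notin square_nodes z -> u \notin V.
    move=> vu uz'; apply/negP => uV; have [z' sz' [h1 h2]] := HE _ _ vV uV vu.
    by rewrite -(uz _ sz' h1) h2 in uz'.
  have side (y : gpoint) : v \notin square_nodes y ->
      (y.1 = z.1 /\ (y.2 = z.2 + 1 \/ y.2 = z.2 - 1)) \/
      (y.2 = z.2 /\ (y.1 = z.1 + 1 \/ y.1 = z.1 - 1)) ->
      (y.1 = z.1 + s /\ y.2 = z.2) \/ (y.1 = z.1 /\ y.2 = z.2 + t).
    move: sv tv vz; rewrite !square_nodesE; clear.
    case: v z y => [v1 v2] [x1 x2] [y1 y2] /= [[-> e1]|[-> e1]] [[-> e2]|[-> e2]]; lia.
  have [sa sb] : is_square V (z.1 + s, z.2) /\ is_square V (z.1, z.2 + t).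
    have [E1|E1] := side _ out1 a1; have [E2|E2] := side _ out2 a2.
    - by case: n12; case: E1 E2 => -> -> [-> ->].
    - by case: E1 E2 => <- <- [<- <-]; case: z1 z2 s1 s2 {e1 e2 out1 out2 a1 a2 n1 n2 n12} => ? ? [? ?].
    - by case: E1 E2 => <- <- [<- <-]; case: z1 z2 s1 s2 {e1 e2 out1 out2 a1 a2 n1 n2 n12} => ? ? [? ?].
    - by case: n12; case: E1 E2 => -> -> [-> ->].
  move: vz; rewrite square_nodesE => vz.
  exists g => //; split=> //; first by rewrite g0.
    apply/andP; split; (apply: nv; first by rewrite -g0 (frame_adj F));
      rewrite square_nodesE /g /=; move: sv tv vz; clear;
      case: v z => [v1 v2] [y1 y2] /= [[-> e1]|[-> e1]] [[-> e2]|[-> e2]]; lia.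
  apply/and4P; split; [| | |apply/and4P; split];
    [apply: (square_mem sz)|apply: (square_mem sz)|apply: (square_mem sz)
    |apply: (square_mem sa)|apply: (square_mem sa)|apply: (square_mem sb)|apply: (square_mem sb)];
    rewrite square_nodesE /g /=; move: sv tv vz; clear;
    case: v z => [v1 v2] [y1 y2] /= [[-> e1]|[-> e1]] [[-> e2]|[-> e2]]; lia.
move=> [g [F g0 /andP[n1 n2] /and4P[h10 h01 h11 /and4P[h20 h21 h02 h12]]] <-].
have F1 : frame (fun i j => g (1 + i) j) by remap F 1 0 1 0 0 1.
have F2 : frame (fun i j => g i (1 + j)) by remap F 0 1 1 0 0 1.
have [z Ez] := frame_square F.
have [z1 Ez1] : exists z1, square_nodes z1 =i [:: g 1 0; g 2 0; g 1 1; g 2 1] := frame_square F1.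
have [z2 Ez2] : exists z2, square_nodes z2 =i [:: g 0 1; g 1 1; g 0 2; g 1 2] := frame_square F2.
have sz : is_square V z by apply/fsubsetP => u; rewrite Ez !inE => /or4P[] /eqP->.
have sz1 : is_square V z1 by apply/fsubsetP => u; rewrite Ez1 !inE => /or4P[] /eqP->.
have sz2 : is_square V z2 by apply/fsubsetP => u; rewrite Ez2 !inE => /or4P[] /eqP->.
have n1z : z1 <> z.
  move=> E; have : g 2 0 \in square_nodes z1 by rewrite Ez1 !inE eqxx orbT.
  by rewrite E Ez !inE !(frame_inj F).
have n2z : z2 <> z.
  move=> E; have : g 0 2 \in square_nodes z2 by rewrite Ez2 !inE eqxx !orbT.
  by rewrite E Ez !inE !(frame_inj F).
split=> //; exists z; split.
- by split=> //; rewrite Ez !inE eqxx.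
- move=> z' sz' vz'; have /andP[A B] := square_at_vertex F vz'.
  have C : g 1 0 \in square_nodes z'.
    by case/orP: A => // /(square_mem sz'); rewrite (negPf n1).
  have D : g 0 1 \in square_nodes z'.
    by case/orP: B => // /(square_mem sz'); rewrite (negPf n2).
  by apply: (square_diagonal_eq F _ _ C D); rewrite Ez !inE eqxx ?orbT.
- move=> [_ [a [b [[az bz ab] H]]]].
  (* Every vertex of the square other than the corner lies in one of the two neighbouring squares,
     so no edge can make it an end-square. *)
  have key u : u \in square_nodes z -> u != g 0 0 ->
      (u \in square_nodes z1) || (u \in square_nodes z2).
    by rewrite Ez Ez1 Ez2 !inE => /or4P[] /eqP->; rewrite ?eqxx ?orbT.
  have [H1 H2] := H _ sz1 n1z; have [H3 H4] := H _ sz2 n2z.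
  have [Ea|ne] := eqVneq a (g 0 0); last by have := key _ az ne; rewrite (negPf H1) (negPf H3).
  have [Eb|ne] := eqVneq b (g 0 0); last by have := key _ bz ne; rewrite (negPf H2) (negPf H4).
  by move: ab; rewrite Ea Eb (frame_adj F).
- exists z1, z2; split=> //.
  + split=> // E; have : g 2 0 \in square_nodes z1 by rewrite Ez1 !inE eqxx orbT.
    by rewrite E Ez2 !inE !(frame_inj F).
  + by exists (g 1 0), (g 1 1); split; split; rewrite ?Ez ?Ez1 ?(frame_adj F) // !inE eqxx ?orbT.
  + by exists (g 0 1), (g 1 1); split; split; rewrite ?Ez ?Ez2 ?(frame_adj F) // !inE eqxx ?orbT.
Qed.

Local Close Scope ring_scope.

Fixpoint last_index (T : eqType) (v : T) (w : seq T) : nat :=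
  if w is _ :: w' then if v \in w' then (last_index v w').+1 else 0 else 0.

Lemma nth_last_index (T : eqType) (x0 v : T) w : v \in w -> nth x0 w (last_index v w) = v.
Proof.
elim: w => //= z w IH; rewrite inE; case: ifP => [vw _|_]; first exact: IH.
by rewrite orbF => /eqP.
Qed.

Lemma index_le_last (T : eqType) (v : T) w : v \in w -> index v w <= last_index v w.
Proof.
elim: w => //= z w IH; rewrite inE eq_sym; case: eqP => //= _ vw.
by rewrite vw ltnS IH.
Qed.

Lemma index_eq_last (T : eqType) (v : T) w : count_mem v w = 1 -> index v w = last_index v w.
Proof.
elim: w => //= z w IH; case: eqP => [_ [/count_memPn/negPf->]|_] //; rewrite add0n => c1.
by rewrite ifT ?IH // -has_pred1 has_count c1.
Qed.

(** The first copy of [u] and the last copy of [v] decide. This also holds for [u] absent from [w],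
    where [index] is the length of [w]. *)
Lemma before_positions (T : eqType) (u v : T) w : v \in w ->
  before w u v = (index u w < last_index v w).
Proof.
elim: w => //= z w IH; rewrite inE; case vw: (v \in w) => /=.
  by rewrite IH // andbT; case: (z =P u).
by rewrite andbF before_notr ?vw.
Qed.

Lemma before_map (T T' : eqType) (h : T -> T') w u v :
  {in w, forall z, (h z == h u) = (z == u)} -> {in w, forall z, (h z == h v) = (z == v)} ->
  before (map h w) (h u) (h v) = before w u v.
Proof.
elim: w => //= z w IH hu hv; rewrite hu ?mem_head // IH; last 2 first.
- by move=> y yw; rewrite hu // inE yw orbT.
- by move=> y yw; rewrite hv // inE yw orbT.
congr (_ && _ || _); apply/mapP/idP => [[y yw /esym/eqP]|vw]; last by exists v.
by rewrite hv ?inE ?yw ?orbT // => /eqP<-.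
Qed.

Lemma grid_no_triangle u v w : grid_adj u v -> grid_adj v w -> ~~ grid_adj u w.
Proof.
move=> /grid_adjP h1 /grid_adjP h2; apply/negP => /grid_adjP h3.
by move: h1 h2 h3; clear; case: u v w => [u1 u2] [v1 v2] [w1 w2] /=; lia.
Qed.

(** * First and last occurrences in a given representing word *)

Section Represented.

Variables (V : {fset gpoint}) (f : gpoint -> nat) (w : seq nat).
Hypotheses (Lf : labeling V f) (Rw : word_represents12 V grid_adj f w).

Let L u := index (f u) w.
Let R u := last_index (f u) w.

Lemma letter_mem u : u \in V -> f u \in w.
Proof. by move=> uV; apply/(proj1 Rw); exists u. Qed.

Lemma first_le_last u : u \in V -> L u <= R u.
Proof. by move=> uV; apply: index_le_last; apply: letter_mem. Qed.

Lemma nonadj_positions u v : u \in V -> v \in V -> f u < f v ->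
  grid_adj u v = ~~ (L u < R v).
Proof.
move=> uV vV uv; have ne : u <> v by move=> E; rewrite E ltnn in uv.
have [_ /(_ u v uV vV ne)] := Rw; rewrite (minn_idPl (ltnW uv)) (maxn_idPr (ltnW uv)).
rewrite -before_positions ?letter_mem // => H.
apply/idP/idP => h.
  by apply/negP => /beforeP-/(_ 0)/(proj2 H); rewrite h.
by apply/negPn/negP => /(proj1 H)/beforeP hb; rewrite hb in h.
Qed.

Lemma adj_positions u v : u \in V -> v \in V -> f u < f v -> grid_adj u v -> R v < L u.
Proof.
move=> uV vV uv; rewrite nonadj_positions // -leqNgt leq_eqVlt => /orP[/eqP E|//].
have := nth_last_index 0 (letter_mem vV); rewrite -/(R v) E /L nth_index ?letter_mem //.
by move=> E'; rewrite E' ltnn in uv.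
Qed.

(** As the grid has no triangles, [p] and [r] are not adjacent, and the positions would satisfy
    [L p < R r < L q <= R q < L p]. *)
Lemma no_monotone_path p q r : p \in V -> q \in V -> r \in V -> f p < f q -> f q < f r ->
  grid_adj p q -> grid_adj q r -> False.
Proof.
move=> pV qV rV pq qr apq aqr.
have h1 := adj_positions pV qV pq apq; have h2 := adj_positions qV rV qr aqr.
have := grid_no_triangle apq aqr; rewrite (nonadj_positions pV rV (ltn_trans pq qr)) negbK => h3.
have h4 := first_le_last qV.
by move: h1 h2 h3 h4; clear; lia.
Qed.

Definition low (u : gpoint) : bool :=
  has (fun v => grid_adj u v && (f u < f v)) (enum_fset V).

(** By [no_monotone_path], a vertex with one larger neighbour has only larger neighbours, so any
    single edge decides. *)
Lemma lowE u v : u \in V -> v \in V -> grid_adj u v -> low u = (f u < f v).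
Proof.
move=> uV vV uv; case: (ltngtP (f u) (f v)) => fuv.
- by apply/hasP; exists v => //; rewrite uv.
- apply/hasP => -[v' v'V /andP[uv' fuv']].
  by apply: (no_monotone_path vV uV v'V fuv fuv') => //; rewrite grid_adj_sym.
- have E : u = v by case: Lf => _; apply.
  by move: uv; rewrite E => /grid_adjP; lia.
Qed.

Lemma represented_split : square_grid_graph V -> split_graph low f V.
Proof.
move=> [_ HX HE]; split.
- move=> u v uV vV uv; rewrite (lowE uV vV uv) (@lowE v u) ?[grid_adj v u]grid_adj_sym //.
  case: ltngtP => // E; have E' : u = v by case: Lf => _; apply.
  by move: uv; rewrite E' => /grid_adjP; lia.
- by move=> u v uV vV uv; rewrite (lowE uV vV uv).
- move=> a1 b1 a2 b2 /and4P[a1V b1V a2V b2V] c1 c2 e1 e2 l1 l2.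
  (* Otherwise the positions form the cycle [R b1 < L a1 < R b2 < L a2 < R b1]. *)
  apply/negPn/negP; rewrite negb_or (nonadj_positions a1V b2V l1) (nonadj_positions a2V b1V l2) !negbK.
  rewrite (lowE a1V b1V e1) in c1; rewrite (lowE a2V b2V e2) in c2.
  have := adj_positions a1V b1V c1 e1; have := adj_positions a2V b2V c2 e2.
  by clear; lia.
- move=> u uV; have [z sz uz] := HX _ uV.
  have [F [g [Fg g0 _]]] : exists v, exists g, [/\ frame g, g 0%R 0%R = u & g 1%R 0%R = v].
    have A : grid_adj u (u.1 + 1, u.2)%R by apply/grid_adjP => /=; clear; lia.
    by have [g [? ? ?]] := frame_edge A; exists (u.1 + 1, u.2)%R, g.
  rewrite -g0 in uz; have /andP[/orP[h|h] _] := square_at_vertex Fg uz.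
    by exists (g 1%R 0%R); [apply: (square_mem sz h) | rewrite -g0 (frame_adj Fg)].
  by exists (g (-1)%R 0%R); [apply: (square_mem sz h) | rewrite -g0 (frame_adj Fg)].
- move=> g Fg g0 g1; have A : grid_adj (g 0%R 0%R) (g 1%R 0%R) by rewrite (frame_adj Fg).
  have [z sz [h0 h1]] := HE _ _ g0 g1 A.
  by have /orP[/andP[h2 h3]|/andP[h2 h3]] := square_at_edge Fg h0 h1;
    rewrite (square_mem sz h2) (square_mem sz h3) ?orbT.
Qed.

(** Let the corner be low; the high case is dual, by reversing labels and word. Induced matchings
    among the eight vertices force, up to swapping axes, the label order [g 1 1], [g 2 1], [g 0 0],
    [g 1 2]. Now [g 1 1] is adjacent to [g 1 2] and the corner to neither, so [L (g 0 0) < R (g 1 2)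
    < L (g 1 1) < R (g 0 0)]: the first and last copies of the corner differ. *)
Lemma corner_not_single v : square_grid_graph V -> corner V v -> count_mem (f v) w <> 1.
Proof.
move=> SV [g [F g00 _ /and4P[g10 g01 g11 /and4P[g20 g21 g02 g12]]] <-] c1.
have HV := represented_split SV.
have Ev : L (g 0%R 0%R) = R (g 0%R 0%R) by exact: index_eq_last.
have A i j k l : coord_adj (i, j) (k, l) -> g i j \in V -> g k l \in V -> low (g k l) = ~~ low (g i j) /\
    if low (g i j) then f (g i j) < f (g k l) /\ R (g k l) < L (g i j)
    else f (g k l) < f (g i j) /\ R (g i j) < L (g k l).
  move=> a h1 h2; have a1 : grid_adj (g i j) (g k l) by rewrite (frame_adj F).
  have c2 := sg_col HV h1 h2 a1; split=> //; case: ifP => ci.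
    by have lt := sg_ord HV h1 h2 a1 ci; split=> //; apply: adj_positions.
  rewrite grid_adj_sym in a1; rewrite ci in c2; have lt := sg_ord HV h2 h1 a1 c2.
  by split=> //; apply: adj_positions.
have N i j k l : ~~ coord_adj (i, j) (k, l) && ~~ coord_adj (k, l) (i, j) -> ~~ ((i == k) && (j == l)) ->
    g i j \in V -> g k l \in V ->
    (f (g i j) < f (g k l) /\ L (g i j) < R (g k l)) \/ (f (g k l) < f (g i j) /\ L (g k l) < R (g i j)).
  move=> /andP[a a'] ne h1 h2; case: (ltngtP (f (g i j)) (f (g k l))) => h.
  - by left; split=> //; rewrite -[_ < _]negbK -nonadj_positions // (frame_adj F).
  - by right; split=> //; rewrite -[_ < _]negbK -nonadj_positions // (frame_adj F).
  - have E : g i j = g k l by case: Lf => _; apply.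
    by move: (frame_inj F i j k l); rewrite E eqxx (negPf ne).
have Lw i j : g i j \in V -> L (g i j) <= R (g i j) by exact: first_le_last.
have [c10 a1] := A 0%R 0%R 1%R 0%R isT g00 g10; have [c01 a2] := A 0%R 0%R 0%R 1%R isT g00 g01.
have [c11 a3] := A 1%R 0%R 1%R 1%R isT g10 g11; have [_ a4] := A 0%R 1%R 1%R 1%R isT g01 g11.
have [c21 a5] := A 1%R 1%R 2%R 1%R isT g11 g21; have [c12 a6] := A 1%R 1%R 1%R 2%R isT g11 g12.
have [_ a7] := A 1%R 0%R 2%R 0%R isT g10 g20; have [_ a8] := A 2%R 1%R 2%R 0%R isT g21 g20.
have [_ a9] := A 0%R 1%R 0%R 2%R isT g01 g02; have [_ a10] := A 1%R 2%R 0%R 2%R isT g12 g02.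
rewrite c21 c11 in a8; rewrite c12 c11 in a10; rewrite c11 in a5 a6.
rewrite c10 in a3 a5 a6 a7 a8 a10; rewrite c01 in a4 a9.
have n1 := N 0%R 0%R 2%R 1%R isT isT g00 g21; have n2 := N 0%R 0%R 1%R 2%R isT isT g00 g12.
have n3 := N 2%R 0%R 0%R 1%R isT isT g20 g01; have n4 := N 0%R 2%R 1%R 0%R isT isT g02 g10.
have n5 := N 0%R 0%R 1%R 1%R isT isT g00 g11; have n6 := N 0%R 0%R 2%R 0%R isT isT g00 g20.
have n7 := N 0%R 0%R 0%R 2%R isT isT g00 g02.
have l1 := Lw _ _ g10; have l2 := Lw _ _ g01; have l3 := Lw _ _ g11.
have l4 := Lw _ _ g20; have l5 := Lw _ _ g02; have l6 := Lw _ _ g21; have l7 := Lw _ _ g12.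
clear A N Lw; move: Ev; move: (low (g 0%R 0%R)) a1 a2 a3 a4 a5 a6 a7 a8 a9 a10 n1 n2 n3 n4 n5 n6 n7 l1 l2 l3 l4 l5 l6 l7.
move: (f (g 0%R 0%R)) (f (g 1%R 0%R)) (f (g 0%R 1%R)) (f (g 1%R 1%R)).
move: (f (g 2%R 0%R)) (f (g 0%R 2%R)) (f (g 2%R 1%R)) (f (g 1%R 2%R)).
move: (L (g 0%R 0%R)) (L (g 1%R 0%R)) (L (g 0%R 1%R)) (L (g 1%R 1%R)).
move: (L (g 2%R 0%R)) (L (g 0%R 2%R)) (L (g 2%R 1%R)) (L (g 1%R 2%R)).
move: (R (g 0%R 0%R)) (R (g 1%R 0%R)) (R (g 0%R 1%R)) (R (g 1%R 1%R)).
move: (R (g 2%R 0%R)) (R (g 0%R 2%R)) (R (g 2%R 1%R)) (R (g 1%R 2%R)).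
clear => Rd Re Ry1 Ry2 Rv Rp Rq Rc Ld Le Ly1 Ly2 Lv Lp Lq Lc fd fe fy1 fy2 fv fp fq fc c.
by case: c => /=; lia.
Qed.

End Represented.

(** * From words over vertices to words over positive labels *)

Section Transfer.

Variables (V : {fset gpoint}) (s w : seq gpoint).
Hypothesis G : good V s w.

Let C : core V s w := good_core G.
Let f (v : gpoint) := (index v s).+1.

Let f_inj u v : v \in V -> (f u == f v) = (u == v).
Proof.
move=> vV; rewrite eqSS; apply/eqP/eqP => [E|->//].
have vs : v \in s by rewrite (core_s C).
have us : u \in s by rewrite -index_mem E index_mem.
by rewrite -(nth_index v us) E nth_index.
Qed.

Lemma transfer_labeling : labeling V f.
Proof. by split=> // u v uV vV /eqP; rewrite f_inj // => /eqP. Qed.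

Lemma transfer_count v : v \in V -> count_mem (f v) (map f w) = count_mem v w.
Proof. by move=> vV; rewrite count_map; apply: eq_count => u /=; rewrite f_inj. Qed.

Lemma transfer_gap v : gap3 v w -> two_between (f v) (map f w).
Proof.
case=> [w1 [p [q [w2 ->]]]]; exists (size w1).
split.
- by rewrite size_map size_cat ltn_add2l.
- by rewrite map_cat nth_cat size_map ltnn subnn.
- by rewrite map_cat nth_cat size_map ltnNge leq_addr addKn.
Qed.

Lemma transfer_represents : word_represents12 V grid_adj f (map f w).
Proof.
split.
  move=> a; split=> [/mapP[u uw ->]|[u uV <-]].
    by exists u => //; rewrite -(core_w C).
  by apply: map_f; rewrite (core_w C).
have main u v : u \in V -> v \in V -> f u < f v ->
    (~~ grid_adj u v <-> occurs_before (f u) (f v) (map f w)).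
  move=> uV vV uv.
  have b : before s u v by rewrite before_index ?(core_uniq C) // (core_s C) vV andbT.
  rewrite (core_rep C b) negbK -(@before_map _ _ f) //; first by split=> [/(beforeP 0)|?] //; apply/(beforeP 0).
  - by move=> z _; rewrite f_inj.
  - by move=> z _; rewrite f_inj.
move=> u v uV vV ne; case: (ltngtP (f u) (f v)) => h.
- exact: main.
- by rewrite grid_adj_sym; apply: main.
- by case: ne; apply/eqP; rewrite -f_inj // h.
Qed.

End Transfer.

Theorem theorem24 (V : {fset gpoint}) :
  square_grid_graph V ->
  representable12 V grid_adj ->
  (exists (f : gpoint -> nat) (w : seq nat),
     [/\ labeling V f,
         word_represents12 V grid_adj f w,
         forall v, corner_node V v -> count_mem (f v) w = 2,
         forall v, corner_node V v -> two_between (f v) w &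
         forall v, v \in V -> ~ corner_node V v -> count_mem (f v) w = 1]) /\
  (forall (f : gpoint -> nat) (w : seq nat),
     good_labeling V grid_adj f ->
     word_represents12 V grid_adj f w ->
     forall v, corner_node V v -> count_mem (f v) w <> 1).
Proof.
move=> SV [f0 [L0 [w0 R0]]]; split; last first.
  by move=> f w [Lf _ _ _] Rw v /(corner_node_corner _ SV); apply: corner_not_single.
have [s [w G]] := split_graph_good (represented_split L0 R0 SV).
exists (fun v => (index v s).+1), (map (fun v => (index v s).+1) w); split.
- exact: transfer_labeling G.
- exact: transfer_represents G.
- move=> v cv; have vV : v \in V by case: cv.
  by rewrite (transfer_count G vV); case: (good_double G (proj1 (corner_node_corner v SV) cv)).
- move=> v /(corner_node_corner _ SV) cv; apply: transfer_gap.
  by case: (good_double G cv).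
- move=> v vV nc; rewrite (transfer_count G vV) (good_single G) // => cv.
  by apply: nc; apply/(corner_node_corner _ SV).
Qed.
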